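(* Let $\lambda$ be a partition and $n\ge\ell(\lambda)$. The maps \[\mathrm{mlq}=\rho\circ\mathrm{revcrw}:\ \mathrm{SSYT}(\lambda,n)\to\mathrm{MLQ}_0(\lambda,n),\qquad \mathrm{tab}=\mathrm{Icol}\circ\mathrm{rw}:\ \mathrm{MLQ}_0(\lambda,n)\to\mathrm{SSYT}(\lambda,n)\] are well defined and are mutually inverse bijections.
   Context: Tableaux. Diagrams in French notation (row 1 at the bottom). $\mathrm{SSYT}(\lambda,n)$ is the set of semistandard Young tableaux of shape $\lambda$ (entries weakly increasing along rows left to right, strictly increasing up columns) with entries in $[n]$. The column reading word $\mathrm{crw}(T)$ reads the columns from left to right, each column from top to bottom; $\mathrm{revcrw}(T)$ is its reverse. For a word $w=w_1\cdots w_k$, $\mathrm{Icol}(w)=w_k\to(\cdots\to(w_2\to(w_1\to\emptyset))\cdots)$ is the tableau obtained by successive Schensted column insertion of $w_1,w_2,\dots,w_k$ into the empty tableau. Multiline queues. For a partition $\lambda$ with $L=\lambda_1$, $\mathrm{MLQ}(\lambda,n)$ is the set of tuples $M=(B_1,\dots,B_L)$ of subsets of $[n]$ with $|B_j|=\lambda'_j$ ($\lambda'$ the conjugate), drawn with rows $1..L$ bottom to top, columns $1..n$ left to right, ball in $(r,j)$ iff $j\in B_r$. Tuples with empty top rows are identified with the tuple obtained by deleting them. The column word $\mathrm{cw}(M)$ scans columns left to right, each top to bottom, recording row numbers of balls; the row word $\mathrm{rw}(M)$ scans rows bottom to top, each row left to right, recording column numbers of balls. Major index: for $r=L,\dots,2$,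 unlabelled balls of row $r$ get label $r$; then balls of row $r$ in decreasing label order (left to right among ties) are each paired with the first unlabelled ball of row $r-1$ weakly to the right, cyclically modulo $n$, which gets the same label; a pairing wraps if the lower ball is strictly left of the upper ball. $\operatorname{maj}(M)=\sum(\ell(p)-r(p)+1)$ over wrapping pairings ($r(p)$ upper row, $\ell(p)$ label). $\mathrm{MLQ}_0(\lambda,n)=\{M:\operatorname{maj}(M)=0\}$. Collapsing and insertion. For a word $w$ and $i\ge1$, $\mathrm{Par}_i(w)$ writes ''('' for each $i+1$ and '')'' for each $i$ and iteratively matches a ''('' with a '')'' to its right when adjacent or separated only by matched parentheses. For $B=(B_1,\dots,B_K)$ a tuple of subsets of $[n]$, $e_i^\star(B)$ moves every ball of row $i+1$ whose letter in $\mathrm{cw}(B)$ is unmatched in $\mathrm{Par}_i(\mathrm{cw}(B))$ down to row $i$ in the same column; $e^\star_{[a,b]}=e^\star_ae^\star_{a+1}\cdots e^\star_b$ (acting right to left) and $\rho_N(B)=e^\star_{[1,K-1]}\cdots e^\star_{[1,1]}(B)$. For a word $w=w_1\cdots w_k$ in $[n]$, $\rho(w)=\rho_N(\{w_1\},\{w_2\},\dots,\{w_k\})$. *)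

(* Defs.v *)
From mathcomp Require Import all_boot.
Set Implicit Arguments. Unset Strict Implicit. Unset Printing Implicit Defensive.

Definition is_partition (la : seq nat) : bool :=
  sorted geq la && all (fun p => 0 < p) la.

(* conj_part la j = la'_{j+1} (conjugate partition, 0-indexed column j). *)
Definition conj_part (la : seq nat) (j : nat) : nat := count (fun p => j < p) la.

(* A tableau is the list of its rows, row 1 (bottom, French) first;
   entries of row r are listed left to right. *)
Definition is_SSYT (la : seq nat) (n : nat) (T : seq (seq nat)) : bool :=
  [&& map size T == la,
      all (all (fun x => 0 < x <= n)) T,
      all (sorted leq) T &
      all (fun r => all (fun j => nth 0 (nth [::] T r) j < nth 0 (nth [::] T r.+1) j)
                        (iota 0 (size (nth [::] T r.+1))))
          (iota 0 (size T).-1)].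

Definition tcol (T : seq (seq nat)) (j : nat) : seq nat :=
  [seq nth 0 r j | r <- T & j < size r].
Definition tcols (T : seq (seq nat)) : seq (seq nat) :=
  [seq tcol T j | j <- iota 0 (size (head [::] T))].
Definition of_cols (C : seq (seq nat)) : seq (seq nat) :=
  [seq [seq nth 0 c i | c <- C & i < size c] | i <- iota 0 (size (head [::] C))].

Definition crw (T : seq (seq nat)) : seq nat := flatten [seq rev c | c <- tcols T].
Definition revcrw (T : seq (seq nat)) : seq nat := rev (crw T).

(* Schensted column insertion x -> C on the column representation:
   x bumps the smallest entry >= x of the first column (which is then
   inserted into the next column), or is placed on top of the column. *)
Fixpoint cinsert (x : nat) (C : seq (seq nat)) : seq (seq nat) :=
  match C with
  | [::] => [:: [:: x]]
  | c :: C' =>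
      if has (fun y => x <= y) c then
        let i := find (fun y => x <= y) c in
        set_nth 0 c i x :: cinsert (nth 0 c i) C'
      else rcons c x :: C'
  end.

Definition Icol (w : seq nat) : seq (seq nat) :=
  of_cols (foldl (fun C x => cinsert x C) [::] w).

(* A tuple (B_1,...,B_K) is a list of rows, row 1 first; each row B_r is
   the list of columns (in [1,n]) containing a ball, in increasing order. *)
Definition is_MLQ (la : seq nat) (n : nat) (M : seq (seq nat)) : bool :=
  (size M == head 0 la) &&
  all (fun j => let B := nth [::] M j in
                [&& sorted ltn B, all (fun c => 0 < c <= n) B & size B == conj_part la j])
      (iota 0 (size M)).

(* identification: delete empty top rows *)
Fixpoint drop_nils (B : seq (seq nat)) : seq (seq nat) :=
  match B with
  | [::] :: B' => drop_nils B'
  | _ => B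
  end.
Definition trim (B : seq (seq nat)) : seq (seq nat) := rev (drop_nils (rev B)).

Definition rw (M : seq (seq nat)) : seq nat := flatten M.

Definition pick_cyc (avail : seq nat) (c : nat) : option nat :=
  let s := sort leq avail in
  match [seq d <- s | c <= d] with
  | d :: _ => Some d
  | [::] => ohead s
  end.

Definition lab_ord (p q : nat * nat) : bool :=
  (q.2 < p.2) || ((p.2 == q.2) && (p.1 <= q.1)).

(* One step r: U = labelled balls (column, label) of row r, lower = balls of
   row r-1. Returns labelled balls of row r-1 (the unpaired ones get label
   r-1) and the accumulated contribution of wrapping pairings. *)
Definition maj_step (r : nat) (st : seq (nat * nat) * nat) (lower : seq nat)
  : seq (nat * nat) * nat :=
  let: (U, acc) := st in
  let: (avail, asg, acc') :=
    foldl (fun (s : seq nat * seq (nat * nat) * nat) (p : nat * nat) =>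
             let: (av, asg, a) := s in
             match pick_cyc av p.1 with
             | Some d => (rem d av, (d, p.2) :: asg,
                          a + (if d < p.1 then p.2 - r + 1 else 0))
             | None => s
             end)
          (lower, [::], acc) (sort lab_ord U) in
  (asg ++ [seq (d, r.-1) | d <- avail], acc').

Definition maj (M : seq (seq nat)) : nat :=
  let L := size M in
  (foldl (fun st r => maj_step r st (nth [::] M r.-2))
         ([seq (c, L) | c <- nth [::] M L.-1], 0)
         (rev (iota 2 L.-1))).2.

Definition is_MLQ0 (la : seq nat) (n : nat) (M : seq (seq nat)) : bool :=
  is_MLQ la n M && (maj M == 0).

(* column word cw(B) as a list of (row, column) of balls: columns 1..n left
   to right, each column top to bottom *)
Definition cw (n : nat) (B : seq (seq nat)) : seq (nat * nat) :=
  flatten [seq [seq (r, c) | r <- rev (iota 1 (size B)) & c \in nth [::] B r.-1]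
          | c <- iota 1 n].

(* columns of the unmatched "(" (letters i+1) in Par_i, via the standard
   left-to-right bracket matching (stack st of pending "(") *)
Fixpoint unmatched (i : nat) (w : seq (nat * nat)) (st : seq nat) : seq nat :=
  match w with
  | [::] => st
  | (r, c) :: w' =>
      if r == i.+1 then unmatched i w' (c :: st)
      else if r == i then unmatched i w' (behead st)
      else unmatched i w' st
  end.

Definition e_star (n i : nat) (B : seq (seq nat)) : seq (seq nat) :=
  let mv := unmatched i (cw n B) [::] in
  let B1 := set_nth [::] B i.-1 (sort leq (nth [::] B i.-1 ++ mv)) in
  set_nth [::] B1 i [seq c <- nth [::] B i | c \notin mv].

Definition e_star_int (n j : nat) (B : seq (seq nat)) : seq (seq nat) :=
  foldl (fun B i => e_star n i B) B (rev (iota 1 j)).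

Definition rhoN (n : nat) (B : seq (seq nat)) : seq (seq nat) :=
  foldl (fun B j => e_star_int n j B) B (iota 1 (size B).-1).

Definition rho (n : nat) (w : seq nat) : seq (seq nat) :=
  rhoN n [seq [:: x] | x <- w].

Definition mlq (n : nat) (T : seq (seq nat)) : seq (seq nat) := trim (rho n (revcrw T)).
Definition tab (M : seq (seq nat)) : seq (seq nat) := Icol (rw M).

(* Main.v *)
Require Import Defs.
From mathcomp Require Import all_boot zify.
Set Implicit Arguments. Unset Strict Implicit. Unset Printing Implicit Defensive.

(** Write [ins [::] w] for the columns of the column insertion tableau of [w].
    Column insertion is compatible with the Knuth relations.  Inserting an
    increasing row [B] into a column [X] bumps out the letters of [X] matched with
    [B] in the bracketing of the two rows [(X, B)], and [e_i^*] changes neither the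
    bumped letters nor the resulting column; hence [e_i^*], and so [rho],
    preserves the insertion tableau of the row word.  As [revcrw T] inserts to [T],
    this gives [tab (mlq T) = T].

    Moreover [maj M = 0] iff each row of [M] can be matched into the row below it,
    weakly to the right.  Passing the rows of such an [M] through their first column
    bumps out rows with the same property and the same sizes, so the column lengths
    of [tab M] are the row sizes of [M].  Applied to all prefixes of [rw M], this
    determines the growth of the shape during the insertion, so that the insertion
    can be undone and [tab] is injective on [MLQ_0].  Finally [rho w] always has the
    matching property, so [mlq T] lies in [MLQ_0], and injectivity yields
    [mlq (tab M) = M]. *)

(** * Column insertion and Knuth relations *)

Definition ins (C : seq (seq nat)) (w : seq nat) :=
  foldl (fun C x => cinsert x C) C w.
(** If no letter of [c] is at least [x], [find] returns [size c]: then [set_nth] appends [x] and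
    nothing is bumped. Bumping and placing on top thus need no case distinction. *)
Definition cput (c : seq nat) (x : nat) := set_nth 0 c (find (leq x) c) x.
Definition cout (c : seq nat) (x : nat) := take 1 (drop (find (leq x) c) c).
Definition puts := foldl cput.
Fixpoint outs (c w : seq nat) : seq nat :=
  if w is x :: w' then cout c x ++ outs (cput c x) w' else [::].

Lemma ins_cat C u v : ins C (u ++ v) = ins (ins C u) v.
Proof. exact: foldl_cat. Qed.

Lemma outs_cat c u v : outs c (u ++ v) = outs c u ++ outs (puts c u) v.
Proof. by elim: u c => //= x u IH c; rewrite IH catA. Qed.

Lemma cinsert_cons x c C : cinsert x (c :: C) = cput c x :: ins C (cout c x).
Proof.
rewrite /cput /cout /=; case: ifP => [h | /negbT h].
  rewrite has_find in h.
  by rewrite (drop_nth 0 h) /= take0.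
have e : find (leq x) c = size c by apply: hasNfind.
by rewrite e drop_size; congr (_ :: _); elim: (c) => //= a l ->.
Qed.

Lemma ins_cons c C w : ins (c :: C) w = puts c w :: ins C (outs c w).
Proof.
elim: w c C => // x w IH c C.
by rewrite -[LHS]/(ins (cinsert x (c :: C)) w) cinsert_cons IH ins_cat.
Qed.

Lemma ins_nil w : w != [::] -> ins [::] w = puts [::] w :: ins [::] (outs [::] w).
Proof. by case: w => // x w _; rewrite -[LHS]/(ins [:: [:: x]] w) ins_cons. Qed.

Lemma size_outs c w : size (outs c w) <= size w.
Proof.
elim: w c => //= x w IH c; rewrite size_cat -addn1 addnC leq_add //.
by rewrite /cout size_take; case: ltnP => // ; lia.
Qed.

(** The form in which insertions are computed below; an empty [s] is the case where [x] goes on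
    top. *)
Lemma cput_split p s x : all (gtn x) p -> x <= head x s ->
  (cput (p ++ s) x = p ++ x :: behead s) * (cout (p ++ s) x = take 1 s).
Proof.
move=> hp hs.
have e : find (leq x) (p ++ s) = size p.
  rewrite find_cat; case: ifP => [/hasP [y yp xy]|_].
    by move/allP: hp => /(_ y yp) /=; lia.
  by case: s hs => [|a s] /=; rewrite ?addn0 // => ->; rewrite addn0.
rewrite /cput /cout e drop_size_cat //; split=> //.
elim: p {hp e} => [|a p IH] /=; first by case: s hs.
by congr (_ :: _).
Qed.

Lemma filter_ltn_cat (c : seq nat) x : sorted ltn c ->
  c = [seq y <- c | y < x] ++ [seq y <- c | x <= y].
Proof.
elim: c => //= a c IH sa.
have := order_path_min ltn_trans sa; have /IH {2}-> := path_sorted sa.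
move=> ha; case: ltnP => //= xa.
rewrite (@eq_in_filter _ _ pred0) ?filter_pred0 //= => y yc.
by move/allP: ha => /(_ y yc); lia.
Qed.

Lemma sorted_split (c : seq nat) x : sorted ltn c ->
  exists p s, [/\ c = p ++ s, all (gtn x) p & all (leq x) s].
Proof.
move=> sc; exists [seq y <- c | y < x], [seq y <- c | x <= y].
by split; [exact: filter_ltn_cat | exact: filter_all | exact: filter_all].
Qed.

Lemma sorted_cat_ltn (p s : seq nat) : sorted ltn (p ++ s) =
  [&& sorted ltn p, sorted ltn s & allrel ltn p s].
Proof.
by rewrite !sorted_pairwise ?pairwise_cat; try exact: ltn_trans; rewrite andbC -andbA andbC -andbA.
Qed.

Lemma cput_sorted c x : sorted ltn c -> sorted ltn (cput c x).
Proof.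
move=> sc; have [p [s [ec hp hs]]] := sorted_split x sc; subst c.
have hx : x <= head x s by case: s hs {sc} => //= a s /andP [].
rewrite (cput_split hp hx).
move: sc; rewrite !sorted_cat_ltn => /and3P [-> ss /allrelP ps] /=.
apply/andP; split.
  case: s ss hs {hx ps} => //= a s; rewrite !(path_sortedE ltn_trans) => /andP [ha ->] /andP [xa _].
  by rewrite andbT; apply: sub_all ha => y /=; lia.
apply/allrelP => y z yp; rewrite inE => /orP [/eqP -> | zs].
  by move/allP: hp => /(_ y yp).
by apply: ps => //; case: (s) zs => //= *; rewrite inE; apply/orP; right.
Qed.

Lemma puts_sorted c w : sorted ltn c -> sorted ltn (puts c w).
Proof. by elim: w c => //= x w IH c sc; apply: IH; apply: cput_sorted. Qed.

Lemma ins_sorted C w : all (sorted ltn) C -> all (sorted ltn) (ins C w).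
Proof.
(* When a column is opened the word must shrink: the first letter put into an empty column bumps
   nothing. *)
have [N] := ubnP (size C + size w); elim: N C w => // N IH [|c C] w h.
  case: (eqVneq w [::]) => [-> //|w0] _; rewrite ins_nil //= puts_sorted //.
  apply: IH => //; case: w w0 h => //= x w _ h.
  by rewrite /cout /= ; have := size_outs (cput [::] x) w; lia.
move=> /= /andP [sc sC]; rewrite ins_cons /= puts_sorted //=; apply: IH => //.
by have := size_outs c w; move: h => /=; lia.
Qed.

(* Knuth relations of the reversed words, since letters are inserted left to right. *)
Inductive kn : seq nat -> seq nat -> Prop :=
| kn_refl u : kn u u
| kn_zxy x y z : x < y -> y <= z -> kn [:: z; x; y] [:: x; z; y]
| kn_yzx x y z : x <= y -> y < z -> kn [:: y; z; x] [:: y; x; z]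
| kn_sym u v : kn u v -> kn v u.


(* Locked, so that [/=] does not unfold the insertions still to be performed. *)
Definition thr c w := locked (puts c w, outs c w).

Lemma thr_nil c : thr c [::] = (c, [::]).
Proof. by rewrite /thr -lock. Qed.

Lemma thr_step c p s x w : c = p ++ s -> all (gtn x) p -> x <= head x s ->
  thr c (x :: w) =
  let r := thr (p ++ x :: behead s) w in (r.1, take 1 s ++ r.2).
Proof. by move=> -> hp hs; rewrite /thr -!lock /= !(cput_split hp hs). Qed.

Lemma thr_kn c u v A D D' : thr c u = (A, D) -> thr c v = (A, D') -> kn D D' ->
  puts c u = puts c v /\ kn (outs c u) (outs c v).
Proof. by rewrite /thr -!lock => -[-> ->] [-> ->]. Qed.

Lemma sorted_split4 (c : seq nat) x y z : sorted ltn c -> x <= y -> y <= z ->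
  exists P Q R S, [/\ c = P ++ Q ++ R ++ S, sorted ltn R, sorted ltn S &
   [/\ forall i, i \in P -> i < x, forall i, i \in Q -> x <= i < y,
       forall i, i \in R -> y <= i < z & forall i, i \in S -> z <= i]].
Proof.
move=> sc xy yz.
have [P [s1 [e1 hP h1]]] := sorted_split x sc; move: sc; rewrite {}e1 sorted_cat_ltn => /and3P [_ s1s _].
have [Q [s2 [e2 hQ h2]]] := sorted_split y s1s; move: s1s h1; rewrite {}e2 sorted_cat_ltn => /and3P [_ s2s _].
have [R [S [e3 hR h3]]] := sorted_split z s2s; move: s2s h2; rewrite {}e3 sorted_cat_ltn => /and3P [Rs Ss _].
rewrite !all_cat => /andP [h2 _] /and3P [h4 _ _].
exists P, Q, R, S; split=> //; split=> i hi.
- exact: (allP hP).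
- by rewrite (allP h4) //; apply: (allP hQ).
- by rewrite (allP h2) //; apply: (allP hR).
- exact: (allP h3).
Qed.

Ltac thr_side :=
  try done;
  try (by rewrite -?catA /= -?catA);
  try (apply/allP => ?; rewrite ?(mem_cat, inE);
       repeat (match goal with |- is_true (_ || _) -> _ => case/orP end);
       match goal with
       | |- is_true (_ == _) -> _ => move/eqP => ->; rewrite /=; lia
       | h : _ |- is_true (_ \in _) -> _ => move/h; rewrite /=; lia
       end);
  try (rewrite /=; lia).
Ltac tstep p s := rewrite (@thr_step _ p s); [rewrite /= ?thr_nil /= | by thr_side ..].

Ltac tend := by rewrite ?take0 /= ?cats0 -?catA /= -?catA.

(** Which letters are bumped depends only on which of the blocks cut out by [x], [y], [z] have few
    letters. In each case the bumped words are equal or differ by one Knuth move, possibly of the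
    other kind. *)
Lemma kn_thr c u v : sorted ltn c -> kn u v ->
  puts c u = puts c v /\ kn (outs c u) (outs c v).
Proof.
move=> sc; elim=> {u v} [w|x y z xy yz|x y z xy yz|u v _ [-> k]]; last by split=> //; apply: kn_sym.
- by split=> //; apply: kn_refl.
- have [P [Q [R [S [-> Rs Ss [hP hQ hR hS]]]]]] := sorted_split4 sc (ltnW xy) yz.
  suff [A [D [D' [e1 e2 k]]]] : exists A D D',
    [/\ thr (P ++ Q ++ R ++ S) [:: z; x; y] = (A, D),
        thr (P ++ Q ++ R ++ S) [:: x; z; y] = (A, D') & kn D D'].
    exact: (thr_kn e1 e2 k).
  have hS0 : z <= head z S by case: S hS {Ss sc} => //= a S h; apply: h; rewrite inE eqxx.
  (* Unless [Q] and [R] are both empty, [z] bumps the head of [S], while [x] and [y] bump some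
     [a < b <= z]. *)
  have out3 a b : a < b -> b <= z -> kn (take 1 S ++ [:: a; b]) (a :: take 1 S ++ [:: b]).
    move=> ab bz; case: S hS0 {Ss hS sc} => [|s S] /= hS0; first exact: kn_refl.
    by rewrite take0; apply: kn_zxy => //; lia.
  case: Q hQ {sc} => [|q Q] hQ.
    case: R hR Rs => [|r R] hR Rs.
      case: S hS Ss hS0 {out3} => [|s [|s' S]] hS Ss /= hS0.
      + exists (P ++ [:: x; y]), [:: z], [:: z]; split; last exact: kn_refl.
          tstep P (Nil nat). tstep P [:: z]. tstep (P ++ [:: x]) (Nil nat). tend.
        tstep P (Nil nat). tstep (P ++ [:: x]) (Nil nat). tstep (P ++ [:: x]) [:: z]. tend.
      + exists (P ++ [:: x; y]), [:: s; z], [:: s; z]; split; last exact: kn_refl.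
          tstep P [:: s]. tstep P [:: z]. tstep (P ++ [:: x]) (Nil nat). tend.
        tstep P [:: s]. tstep (P ++ [:: x]) (Nil nat). tstep (P ++ [:: x]) [:: z]. tend.
      (* Both words bump [s] first here, and the relation becomes one of the other kind. *)
      + have h' : z <= s' by apply: hS; rewrite !inE eqxx orbT.
        exists (P ++ [:: x, y & S]), [:: s; z; s'], [:: s; s'; z]; split.
        * tstep P [:: s, s' & S]. tstep P [:: z, s' & S]. tstep (P ++ [:: x]) (s' :: S). tend.
        * tstep P [:: s, s' & S]. tstep (P ++ [:: x]) (s' :: S). tstep (P ++ [:: x]) (z :: S). tend.
        * by apply/kn_sym/kn_yzx; move: Ss => //= /andP [].
    have hr : y <= r < z by apply: hR; rewrite inE eqxx.
    have {}hR i : i \in R -> y <= i < z by move=> hi; apply: hR; rewrite inE hi orbT.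
    case: R hR Rs => [|r' R] hR Rs.
      exists (P ++ [:: x, y & behead S]), (take 1 S ++ [:: r; z]), (r :: take 1 S ++ [:: z]).
      split; last by apply: out3; lia.
        tstep (P ++ [:: r]) S. tstep P [:: r, z & behead S]. tstep (P ++ [:: x]) (z :: behead S).
        tend.
      tstep P (r :: S). tstep (P ++ [:: x]) S. tstep (P ++ [:: x]) (z :: behead S).
      tend.
    have hr' : y <= r' < z by apply: hR; rewrite inE eqxx.
    have {}hR i : i \in R -> y <= i < z by move=> hi; apply: hR; rewrite inE hi orbT.
    exists (P ++ [:: x, y & R ++ z :: behead S]), (take 1 S ++ [:: r; r']), (r :: take 1 S ++ [:: r']).
    split; last by apply: out3; [move: Rs => /= /andP [] | lia].
      tstep (P ++ [:: r, r' & R]) S. tstep P [:: r, r' & R ++ z :: behead S].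
      tstep (P ++ [:: x]) (r' :: R ++ z :: behead S).
      tend.
    tstep P (r :: r' :: R ++ S). tstep (P ++ [:: x, r' & R]) S. tstep (P ++ [:: x]) (r' :: R ++ z :: behead S).
    tend.
  have hq : x <= q < y by apply: hQ; rewrite inE eqxx.
  have {}hQ i : i \in Q -> x <= i < y by move=> hi; apply: hQ; rewrite inE hi orbT.
  case: R hR Rs => [|r R] hR Rs.
    exists (P ++ x :: Q ++ y :: behead S), (take 1 S ++ [:: q; z]), (q :: take 1 S ++ [:: z]).
    split; last by apply: out3; lia.
      tstep (P ++ q :: Q) S. tstep P (q :: Q ++ z :: behead S). tstep (P ++ x :: Q) (z :: behead S).
      tend.
    tstep P (q :: Q ++ S). tstep (P ++ x :: Q) S. tstep (P ++ x :: Q) (z :: behead S).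
    tend.
  have hr : y <= r < z by apply: hR; rewrite inE eqxx.
  have {}hR i : i \in R -> y <= i < z by move=> hi; apply: hR; rewrite inE hi orbT.
  exists (P ++ x :: Q ++ y :: R ++ z :: behead S), (take 1 S ++ [:: q; r]), (q :: take 1 S ++ [:: r]).
  split; last by apply: out3; lia.
    tstep (P ++ q :: Q ++ r :: R) S. tstep P (q :: Q ++ r :: R ++ z :: behead S).
    tstep (P ++ x :: Q) (r :: R ++ z :: behead S).
    tend.
  tstep P (q :: Q ++ r :: R ++ S). tstep (P ++ x :: Q ++ r :: R) S. tstep (P ++ x :: Q) (r :: R ++ z :: behead S).
  tend.
- have [P [Q [R [S [-> Rs Ss [hP hQ hR hS]]]]]] := sorted_split4 sc xy (ltnW yz).
  suff [A [D [D' [e1 e2 k]]]] : exists A D D',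
    [/\ thr (P ++ Q ++ R ++ S) [:: y; z; x] = (A, D),
        thr (P ++ Q ++ R ++ S) [:: y; x; z] = (A, D') & kn D D'].
    exact: (thr_kn e1 e2 k).
  have hS0 : z <= head z S by case: S hS {Ss sc} => //= a S h; apply: h; rewrite inE eqxx.
  have hS1 : y <= head y S by case: (S) hS0 => //= *; lia.
  (* After [y], the column is [P ++ Q ++ y :: V ++ W] with [V < z <= W]. *)
  have [V [W [b [e hV hW hb]]]] : exists V W b,
     [/\ thr (P ++ Q ++ R ++ S) [:: y] = (P ++ Q ++ y :: V ++ W, b),
        forall i, i \in V -> y <= i < z, z <= head z W &
        (b = [::] /\ W = [::]) \/ exists t, [/\ b = [:: t], y <= t & t < head t.+1 W]].
    case: R hR Rs {sc} => [|r R] hR Rs.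
      exists [::], (behead S), (take 1 S); split=> //.
      + tstep (P ++ Q) S; tend.
      + case: S Ss hS {hS0 hS1} => //= s [|s' S] //= _ hS; apply: hS; rewrite !inE eqxx orbT //.
      + case: S Ss hS hS0 {hS1} => [|s S] /= Ss hS hS0; [by left | right; exists s].
        rewrite take0; split=> //; first by lia.
        by case: S Ss {hS} => //= s' S /andP [].
    have hr : y <= r < z by apply: hR; rewrite inE eqxx.
    have {}hR i : i \in R -> y <= i < z by move=> hi; apply: hR; rewrite inE hi orbT.
    exists R, S, [:: r]; split=> //.
    + tstep (P ++ Q) (r :: R ++ S); tend.
    + right; exists r; split; try lia; by case: (S) hS0 => //= *; lia.
  have e3 u : thr (P ++ Q ++ R ++ S) (y :: u) =
      ((thr (P ++ Q ++ y :: V ++ W) u).1, b ++ (thr (P ++ Q ++ y :: V ++ W) u).2).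
    by move: e; rewrite /thr -!lock /= cats0 => -[-> ->].
  (* The letter [z] bumps the head of [W] and [x] bumps some [a <= y]; the letter [t] bumped by [y]
     lies between them and witnesses the exchange. *)
  have knb a : a <= y -> kn (b ++ take 1 W ++ [:: a]) (b ++ a :: take 1 W).
    move=> ay; case: hb => [[-> ->]|[t [-> yt]]]; first exact: kn_refl.
    case: (W) => [|s W'] /=; first by move=> _; apply: kn_refl.
    by move=> ts; rewrite take0; apply: kn_yzx => //; lia.
  rewrite !e3.
  case: Q hQ {sc e e3} => [|q Q] hQ.
    exists (P ++ x :: V ++ z :: behead W), (b ++ take 1 W ++ [:: y]), (b ++ y :: take 1 W).
    split; last exact: knb.
      tstep (P ++ y :: V) W. tstep P (y :: V ++ z :: behead W). tend.
    tstep P (y :: V ++ W). tstep (P ++ x :: V) W. tend.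
  have hq : x <= q < y by apply: hQ; rewrite inE eqxx.
  have {}hQ i : i \in Q -> x <= i < y by move=> hi; apply: hQ; rewrite inE hi orbT.
  exists (P ++ x :: Q ++ y :: V ++ z :: behead W), (b ++ take 1 W ++ [:: q]), (b ++ q :: take 1 W).
  split; last by apply: knb; lia.
    tstep (P ++ q :: Q ++ y :: V) W. tstep P (q :: Q ++ y :: V ++ z :: behead W). tend.
  tstep P (q :: Q ++ y :: V ++ W). tstep (P ++ x :: Q ++ y :: V) W. tend.
Qed.

Lemma kn_ins C u v : all (sorted ltn) C -> kn u v -> ins C u = ins C v.
Proof.
have [N] := ubnP (size C + size u); elim: N C u v => // N IH [|c C] u v h.
  move=> _ k; have e : (u == [::]) = (v == [::]) by elim: k => //= ? ? _ ->.
  case: (eqVneq u [::]) e => [-> /esym /eqP -> //|u0 /esym/negbT v0].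
  rewrite (ins_nil u0) (ins_nil v0); have [-> k'] := kn_thr (isT : sorted ltn [::]) k.
  congr (_ :: _); apply: IH => //; case: u u0 h {k k'} => //= x u _ h.
  by rewrite /cout /=; have := size_outs (cput [::] x) u; lia.
move=> /= /andP [sc sC] k; rewrite !ins_cons; have [-> k'] := kn_thr sc k.
by congr (_ :: _); apply: IH => //; have := size_outs c u; move: h => /=; lia.
Qed.

(** * Plactic equivalence and bracket scans *)

(** The quantifier over [C] makes this a congruence for concatenation on either side. *)
Definition pleq u v := forall C, all (sorted ltn) C -> ins C u = ins C v.

Lemma pleq_trans v u w : pleq u v -> pleq v w -> pleq u w.
Proof. by move=> h1 h2 C hC; rewrite h1 // h2. Qed.

Lemma pleq_ctx a b u v : pleq u v -> pleq (a ++ u ++ b) (a ++ v ++ b).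
Proof. by move=> h C hC; rewrite !ins_cat h // ins_sorted. Qed.

Lemma kn_pleq u v : kn u v -> pleq u v.
Proof. by move=> k C hC; apply: kn_ins. Qed.

(** The letter [x] passes those of [s] from the right by [kn_yzx], each time witnessed by the letter
    before the one passed. The last witness is [y], which stays in front. *)
Lemma pleq_move_small y s x : sorted ltn (y :: s) -> x <= y ->
  pleq (y :: s ++ [:: x]) [:: y, x & s].
Proof.
elim/last_ind: s => [|s z IH] // hs xy.
move: hs; rewrite -rcons_cons -cats1 sorted_cat_ltn => /and3P [hs _ /allrelP hz].
apply: (@pleq_trans (y :: s ++ [:: x; z])); last first.
  have /(@pleq_ctx [::] [:: z]) := IH hs xy.
  by rewrite /= -!catA /= cats1.
have xs : forall w, w \in y :: s -> x <= w.
  move=> w; rewrite inE => /orP [/eqP -> //|ws].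
  by move: hs => /= /(order_path_min ltn_trans) /allP /(_ w ws); lia.
rewrite -cats1 -catA /=.
case/lastP: s {IH hs} hz xs => [|s w] hz xs.
  by apply: kn_pleq; apply: kn_yzx => //; apply: hz; rewrite inE.
rewrite -cats1 -!catA -!cat_cons.
have k : kn ([:: w] ++ [:: z; x]) ([:: w] ++ [:: x; z]).
  have hw : w \in y :: rcons s w by rewrite !inE mem_rcons inE eqxx orbT.
  by apply: kn_yzx; [exact: xs | apply: hz => //; rewrite inE].
by have := @pleq_ctx (y :: s) [::] _ _ (kn_pleq k); rewrite /= ?cats0.
Qed.

(** Dually, [y] passes the letters of [p] from the right by [kn_zxy], witnessed by the letter that
    follows [y]. *)
Lemma pleq_move_big y p x : sorted ltn (p ++ [:: x]) -> x <= y ->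
  pleq (p ++ [:: y; x]) (y :: p ++ [:: x]).
Proof.
elim: p => [|a p IH] // hs xy.
have {}/IH IH := path_sorted hs.
apply: (@pleq_trans (a :: y :: p ++ [:: x])).
  by have := @pleq_ctx [:: a] [::] _ _ (IH xy); rewrite !cats0.
case: p hs {IH} => [|b p] /= => [/andP [ax _]|/andP [ab hp]].
  by apply: kn_pleq; apply/kn_sym/kn_zxy.
have k : kn [:: a; y; b] [:: y; a; b].
  apply/kn_sym/kn_zxy => //.
  move: hp; rewrite (path_sortedE ltn_trans) all_cat /= => /andP [/andP [_ /andP [h _]] _].
  by lia.
exact: (@pleq_ctx [::] (p ++ [:: x]) _ _ (kn_pleq k)).
Qed.

(** The new letter moves left until it stands just behind the letter it bumps, which then moves to
    the front. *)
Lemma pleq_cput c x : sorted ltn c -> pleq (rcons c x) (cout c x ++ cput c x).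
Proof.
move=> sc; have [p [s [e hp hs]]] := sorted_split x sc; subst c.
have hx : x <= head x s by case: s hs {sc} => //= a s /andP [].
rewrite !(cput_split hp hx) -cats1.
case: s sc hs hx => [|y s] sc hs /= hx; first by rewrite cats0.
rewrite take0 -catA.
move: sc; rewrite sorted_cat_ltn => /and3P [sp ss _].
apply: (@pleq_trans (p ++ [:: y, x & s])).
  by have := @pleq_ctx p [::] _ _ (pleq_move_small ss hx); rewrite !cats0.
have spx : sorted ltn (p ++ [:: x]).
  by rewrite sorted_cat_ltn sp /=; apply/allrelP => a b ap; rewrite inE => /eqP ->; move/allP: hp; apply.
have := @pleq_ctx [::] s _ _ (pleq_move_big spx hx).
by rewrite /= -!catA.
Qed.

Lemma pleq_puts c w : sorted ltn c -> pleq (c ++ w) (outs c w ++ puts c w).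
Proof.
elim: w c => [|x w IH] c sc; first by rewrite cats0.
rewrite -cat_rcons /= -catA.
apply: (@pleq_trans (cout c x ++ cput c x ++ w)).
  by have := @pleq_ctx [::] w _ _ (pleq_cput x sc); rewrite -catA.
have := @pleq_ctx (cout c x) [::] _ _ (IH _ (cput_sorted x sc)).
by rewrite !cats0.
Qed.

Lemma perm_cput c x : sorted ltn c -> perm_eq (cput c x ++ cout c x) (rcons c x).
Proof.
move=> sc; have [p [s [e hp hs]]] := sorted_split x sc; subst c.
have hx : x <= head x s by case: s hs {sc} => //= a s /andP [].
rewrite !(cput_split hp hx) -cats1.
case: s {sc hs hx} => [|y s] /=; first by rewrite !cats0.
by rewrite take0; apply/permP => a; rewrite ?count_cat /= ?count_cat /=; lia.
Qed.

Lemma perm_puts c w : sorted ltn c -> perm_eq (puts c w ++ outs c w) (c ++ w).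
Proof.
elim: w c => [|x w IH] c sc //=.
have /permP h1 := IH _ (cput_sorted x sc); have /permP h2 := perm_cput x sc.
apply/permP => a; move: (h1 a) (h2 a).
by rewrite !count_cat -cats1 !count_cat /=; lia.
Qed.

Section Scan.
Variables (p q : pred nat).

(* Column [c] contributes an opening bracket if [p c], followed by a closing one
   if [q c]; [h] is the number of pending opening brackets. *)
Fixpoint mclose (h : nat) (cs : seq nat) : seq nat :=
  if cs is c :: cs' then
    if q c then
      if p c + h is h'.+1 then c :: mclose h' cs' else mclose 0 cs'
    else mclose (p c + h) cs'
  else [::].

(* Returns the unmatched opening brackets and the number of unmatched closing ones. *)
Fixpoint mopen (cs : seq nat) : seq nat * nat :=
  if cs is c :: cs' then
    let: (U, f) := mopen cs' in
    if p c then
      if q c + f is f'.+1 then (U, f') else (c :: U, 0)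
    else (U, q c + f)
  else ([::], 0).
End Scan.

Lemma eq_mclose p q p' q' h cs : {in cs, p =1 p'} -> {in cs, q =1 q'} ->
  mclose p q h cs = mclose p' q' h cs.
Proof.
elim: cs h => //= c cs IH h hp hq.
have i1 : {in cs, p =1 p'} by move=> x xc; apply: hp; rewrite inE xc orbT.
have i2 : {in cs, q =1 q'} by move=> x xc; apply: hq; rewrite inE xc orbT.
rewrite hp ?hq ?inE ?eqxx //; case: ifP => _; last exact: IH.
by case: (_ + _) => [|h']; rewrite IH.
Qed.

Lemma mopen_sub p q cs : {subset (mopen p q cs).1 <= [pred c | [&& p c, ~~ q c & c \in cs]]}.
Proof.
elim: cs => //= c cs; case: (mopen p q cs) => U f /= IH x.
have IH' : x \in U -> [&& p x, ~~ q x & x \in c :: cs].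
  by move=> /IH; rewrite !inE /= => /and3P [-> -> ->]; rewrite orbT.
case: ifP => pc; last exact: IH'.
case: (boolP (q c)) => qc /=; first exact: IH'.
case: f {IH} => [|f]; last exact: IH'.
by rewrite inE => /orP [/eqP -> | /IH' //]; rewrite inE pc qc inE eqxx.
Qed.

(** At an unmatched opening bracket no bracket that will be matched is pending, so once flipped it
    closes nothing. The [minn] discards initial brackets that find no partner in [cs] and would
    otherwise match a flipped one. *)
Lemma mclose_flip p q h cs : uniq cs ->
  let U := (mopen p q cs).1 in
  mclose p q h cs =
  mclose (fun c => p c && (c \notin U)) (fun c => q c || (c \in U))
    (minn h (mopen p q cs).2) cs.
Proof.
elim: cs h => // c cs IH h /andP [ncs ucs].
have hs := @mopen_sub p q cs; rewrite /=.
case E: (mopen p q cs) IH hs => [U f] /= IH hs.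
have cU : c \in U = false by apply/negbTE; apply: contra ncs => /hs /= /and3P [].
have neq x : x \in cs -> (x == c) = false.
  by move=> xc; apply/eqP => e; rewrite -e xc in ncs.
case pc : (p c); case qc : (q c); rewrite /= ?cU ?pc ?qc /=.
- by rewrite IH.
- case: f {E} IH => [|f] IH /=.
    rewrite mem_head /= ?minn0 IH // ?minn0 /=.
    by apply: eq_mclose => x xc; rewrite inE neq.
  by rewrite ?cU IH //= add1n; congr mclose; lia.
- rewrite add0n; case: h => [|h] /=; first by rewrite ?min0n IH // ?min0n.
  have -> : 0 + minn h.+1 (1 + f) = (minn h f).+1 by lia.
  by rewrite IH.
- by rewrite IH.
Qed.

(** The set of matched closing brackets does not depend on which opening bracket takes which, so a
    pending one may claim the first. This mirrors the bumping of the first letter that is not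
    smaller. *)
Lemma mclose_succ p q h cs : uniq cs ->
  mclose p q h.+1 cs =
  if [seq c <- cs | q c] is y :: _
  then y :: mclose p (fun c => q c && (c != y)) h cs else [::].
Proof.
elim: cs h => //= c cs IH h /andP [ncs ucs].
case: ifP => qc; rewrite addnS /=.
  rewrite ?qc eqxx /=; congr (_ :: _); apply: eq_mclose => // x xc.
  by rewrite (_ : x != c) ?andbT //; apply: contraNneq ncs => <-.
by rewrite IH //; case: [seq _ <- _ | _] => //= y _; rewrite ?qc.
Qed.

Lemma mclose_nop p q cs1 cs2 : {in cs1, p =1 pred0} ->
  mclose p q 0 (cs1 ++ cs2) = mclose p q 0 cs2.
Proof.
elim: cs1 => //= c cs IH h; rewrite (h c (mem_head _ _)) /= IH ?if_same //.
by move=> x xc; apply: h; rewrite inE xc orbT.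
Qed.

Lemma mclose_noq p q h cs : {in cs, q =1 pred0} -> mclose p q h cs = [::].
Proof.
elim: cs h => //= c cs IH h hq; rewrite (hq c (mem_head _ _)) /= IH //.
by move=> x xc; apply: hq; rewrite inE xc orbT.
Qed.

Definition row n (B : seq nat) := sorted ltn B && all (fun c => 0 < c <= n) B.

Lemma row_mem n B c : row n B -> c \in B -> 0 < c <= n.
Proof. by case/andP => _ /allP h /h. Qed.

Lemma row_sorted n B : row n B -> sorted ltn B.
Proof. by case/andP. Qed.

Lemma row_uniq n B : row n B -> uniq B.
Proof. by move/row_sorted; apply: sorted_uniq; [exact: ltn_trans | exact: ltnn]. Qed.

Lemma row_cons n b B : row n (b :: B) ->
  [/\ row n B, 0 < b <= n & forall x, x \in B -> b < x].
Proof.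
rewrite /row /= (path_sortedE ltn_trans) => /andP [/andP [/allP h ->] /andP [-> ->]].
by split.
Qed.

Lemma row_cput n c x : row n c -> 0 < x <= n -> row n (cput c x).
Proof.
move=> rc hx; rewrite /row cput_sorted ?(row_sorted rc) //=.
apply/allP => y hy; have := perm_cput x (row_sorted rc) => /perm_mem /(_ y).
rewrite mem_cat hy /= mem_rcons inE => /esym /orP [/eqP -> //|].
exact: row_mem.
Qed.

Lemma row_puts n c w : row n c -> all (fun x => 0 < x <= n) w -> row n (puts c w).
Proof. by elim: w c => //= x w IH c rc /andP [hx hw]; apply: IH => //; apply: row_cput. Qed.

Lemma iota_split n b : 0 < b <= n -> iota 1 n = iota 1 b.-1 ++ b :: iota b.+1 (n - b).
Proof.
move=> h; have {1}-> : n = b.-1 + (n - b).+1 by lia.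
by rewrite iotaD /=; congr (_ ++ _ :: iota _ _); lia.
Qed.

(** The smallest letter [b] of [B] opens the first bracket and, by [mclose_succ], may claim the
    first letter of [X] from column [b] on, which is the letter it bumps. That [b] joins the column
    is harmless, since the remaining letters of [B] are larger. *)
Lemma outs_mclose n X B : row n X -> row n B ->
  outs X B = mclose (mem B) (mem X) 0 (iota 1 n).
Proof.
elim: B X => [|b B IH] X rX rB.
  by rewrite -[iota 1 n]cats0 mclose_nop.
have [rB' hb hB] := row_cons rB.
rewrite /= IH ?row_cput //; have sX := row_sorted rX.
have [P [S [e hP hS]]] := sorted_split b sX; subst X.
have hb' : b <= head b S by case: S hS {sX rX} => //= a s /andP [].
rewrite !(cput_split hP hb') (iota_split hb) !mclose_nop; last 2 first.
- move=> x; rewrite mem_iota inE /= inE => hx; apply/negbTE/negP => /orP [/eqP|/hB]; lia.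
- by move=> x; rewrite mem_iota => hx; apply/negbTE/negP => /hB; lia.
set post := iota _ _.
have hpost x : x \in post -> b < x by rewrite mem_iota; lia.
have nP x : x \in post -> x \in P = false.
  by move=> /hpost hx; apply/negbTE/negP => /(allP hP) /=; lia.
have bB : b \in B = false by apply/negbTE/negP => /hB; lia.
have bP : b \in P = false by apply/negbTE/negP => /(allP hP) /=; lia.
have pB : {in post, mem (b :: B) =1 mem B}.
  by move=> x /hpost hx; rewrite /= inE gtn_eqF.
rewrite /= !mem_cat bP bB !inE eqxx /= addn0; apply/esym.
(* If [b] is in [X], it bumps itself, as the two brackets of its column match each other. *)
case: ifP => [bS|bS].
  have [S' eS] : exists S', S = b :: S'.
    case: S bS hS hb' sX {rX} => // a S'; rewrite inE => /orP [/eqP -> *|bS]; first by exists S'.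
    move=> _ /= ba; rewrite sorted_cat_ltn => /and3P [_ h _]; exfalso.
    by move: (order_path_min ltn_trans h) => /allP /(_ _ bS); lia.
  by rewrite eS /= take0 /=; congr (_ :: _); apply: eq_mclose.
have [uS sS] : uniq S /\ sorted ltn S.
  move: (row_uniq rX); rewrite cat_uniq => /and3P [_ _ ->].
  by move: sX; rewrite sorted_cat_ltn => /and3P [].
have fS : [seq c <- post | c \in P ++ S] = S.
  apply: (irr_sorted_eq ltn_trans ltnn) => //.
    by apply: sorted_filter; [exact: ltn_trans | exact: iota_ltn_sorted].
  move=> x; rewrite mem_filter mem_cat; case xp: (x \in post) => /=.
    by rewrite nP // andbT.
  rewrite andbF; apply/esym/negbTE; apply: contraFN xp => xS.
  have : x != b by apply: contraFneq bS => <-.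
  have /andP [] : 0 < x <= n by apply: (row_mem rX); rewrite mem_cat xS orbT.
  by move/allP: hS => /(_ _ xS); rewrite mem_iota; lia.
rewrite mclose_succ ?iota_uniq // fS.
case: S fS uS {hS hb' sX rX bS sS} => [|y S] fS uS.
  by rewrite mclose_noq // => x xp; rewrite /= mem_cat nP // inE; move: (hpost _ xp); lia.
rewrite /= take0 /=; congr (_ :: _); apply: eq_mclose => // x xp.
rewrite /= !mem_cat nP // !inE; move: (hpost _ xp) => hx.
rewrite [x == b]gtn_eqF //=; case: eqP => //= [->|_]; last by rewrite andbT.
by move: uS => /= /andP [/negbTE -> _].
Qed.

(** * The operators e_i^* *)

Lemma mopen_subseq p q cs : subseq (mopen p q cs).1 cs.
Proof.
elim: cs => // c cs /=; case: (mopen p q cs) => U f /= IH.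
have IH' : subseq U (c :: cs) by apply: (subseq_trans IH); apply: subseq_cons.
by case: ifP => _ //; case: (q c + f) => [|f'] //=; rewrite eqxx.
Qed.

Lemma mopen_cat p q cs1 cs2 : exists2 V,
  (mopen p q (cs1 ++ cs2)).1 = V ++ (mopen p q cs2).1 & {subset V <= cs1}.
Proof.
elim: cs1 => [|c cs [V]]; first by exists [::].
rewrite /=; case: (mopen p q (cs ++ cs2)) => U f /= -> hV.
have hV' : {subset V <= c :: cs} by move=> x /hV; rewrite inE orbC => ->.
case: ifP => _; last by exists V.
case: (q c + f) => [|f'] /=; last by exists V.
exists (c :: V) => // x; rewrite !inE => /orP [->//|/hV ->]; exact: orbT.
Qed.

Lemma mopen_count p q cs :
  size (mopen p q cs).1 + count q cs = count p cs + (mopen p q cs).2.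
Proof.
elim: cs => // c cs /=; case: (mopen p q cs) => U f /= IH.
by case: (p c) => /=; [case E: (q c + f) => [|f'] /=; lia | lia].
Qed.

(** An opening bracket is unmatched only when every closing bracket from its column on is used, and
    on that suffix the second hypothesis bounds the number of [y] by these. *)
Lemma mopen_max (p q y : pred nat) cs : {in cs, forall c, y c -> p c} ->
  (forall cs1 cs2, cs = cs1 ++ cs2 -> count y cs2 <= count q cs2) ->
  count y cs + size (mopen p q cs).1 <= count p cs.
Proof.
elim: cs => // c cs IH hyp hs.
have i1 : {in cs, forall c, y c -> p c} by move=> x xc; apply: hyp; rewrite inE xc orbT.
have {IH i1} := IH i1 (fun a b e => hs (c :: a) b (congr1 (cons c) e)).
have := hyp c (mem_head _ _); have {hyp hs} := hs [::] (c :: cs) erefl.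
have := mopen_count p q cs.
rewrite /=; case: (mopen p q cs) => U f /=.
by case: (p c) => /=; [case E: (q c + f) => [|f'] /=; lia | case: (y c) => [_ _ /(_ isT)|]; lia].
Qed.

Lemma unmatched_skip i w w' st :
  all (fun rc : nat * nat => (rc.1 != i) && (rc.1 != i.+1)) w ->
  unmatched i (w ++ w') st = unmatched i w' st.
Proof.
elim: w => //= -[r c] w IH /= /andP [/andP [h1 h2] h].
by rewrite (negbTE h1) (negbTE h2) IH.
Qed.

Definition push (p q : pred nat) c st :=
  let st1 := if p c then c :: st else st in if q c then behead st1 else st1.

Lemma unmatched_col i (B : seq (seq nat)) c w st : 0 < i < size B ->
  unmatched i ([seq (r, c) | r <- rev (iota 1 (size B)) & c \in nth [::] B r.-1] ++ w) st =
  unmatched i w (push (mem (nth [::] B i)) (mem (nth [::] B i.-1)) c st).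
Proof.
move=> hi; have -> : iota 1 (size B) = iota 1 i.-1 ++ [:: i; i.+1] ++ iota i.+2 (size B - i.+1).
  have {1}-> : size B = i.-1 + (2 + (size B - i.+1)) by lia.
  by rewrite !iotaD /=; congr (_ ++ [:: _, _ & iota _ _]); lia.
rewrite !rev_cat !filter_cat !map_cat -!catA unmatched_skip; last first.
  by apply/allP => x /mapP [r]; rewrite mem_filter mem_rev mem_iota => /andP [_ h] -> /=; lia.
rewrite /push (_ : rev [:: i; i.+1] = [:: i.+1; i]) //=.
have skip st' : unmatched i
  ([seq (r, c) | r <- [seq r <- rev (iota 1 i.-1) | c \in nth [::] B r.-1]] ++ w) st' =
  unmatched i w st'.
  apply: unmatched_skip.
  by apply/allP => x /mapP [r]; rewrite mem_filter mem_rev mem_iota => /andP [_ h] -> /=; lia.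
have e1 : (i == i.+1) = false by lia.
by case: (c \in nth _ B i) => /=; case: (c \in nth _ B i.-1) => /=;
  rewrite ?eqxx ?e1 ?skip.
Qed.

Lemma unmatched_mopen i n B : 0 < i < size B ->
  unmatched i (cw n B) [::] =
  rev (mopen (mem (nth [::] B i)) (mem (nth [::] B i.-1)) (iota 1 n)).1.
Proof.
move=> hi; rewrite /cw.
(* Generalised over the stack: the unmatched closing brackets of the remaining columns pop that many
   pending ones. *)
suff h cs st : unmatched i (flatten [seq [seq (r, c)
    | r <- rev (iota 1 (size B)) & c \in nth [::] B r.-1] | c <- cs]) st =
    rev (mopen (mem (nth [::] B i)) (mem (nth [::] B i.-1)) cs).1
    ++ drop (mopen (mem (nth [::] B i)) (mem (nth [::] B i.-1)) cs).2 st.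
  by rewrite h cats0.
elim: cs st => [|c cs IH] st; first by rewrite /= drop0.
rewrite [flatten _]/= unmatched_col // IH /push /=.
case: (mopen _ _ cs) => U f /=.
case: (c \in nth [::] B i); case: (c \in nth [::] B i.-1) => //=.
  by case: f => [|f] //=; rewrite drop0 rev_cons -cats1 -catA.
by rewrite add1n; case: st.
Qed.

(* By Hall's criterion: [B] has an injection into [X] that never moves left. *)
Definition dom (B X : seq nat) := forall x, count (leq x) B <= count (leq x) X.

Lemma dom_trans Y X Z : dom X Y -> dom Y Z -> dom X Z.
Proof. by move=> h1 h2 x; apply: leq_trans (h2 x). Qed.

Lemma dom_size B X : dom B X -> size B <= size X.
Proof. by move/(_ 0); rewrite !(@eq_count _ (leq 0) predT) // !count_predT. Qed.

Lemma dom_sub n B X : row n B -> {subset B <= X} -> dom B X.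
Proof.
move=> /row_uniq uB h x; rewrite -!size_filter; apply: uniq_leq_size.
  exact: filter_uniq.
by move=> y; rewrite !mem_filter => /andP [-> /h].
Qed.

Lemma row_count n B a : row n B ->
  count a B = count (mem B) [seq c <- iota 1 n | a c].
Proof.
move=> rB; rewrite -!size_filter; apply: perm_size; apply: uniq_perm.
- by apply: filter_uniq; apply: row_uniq rB.
- by rewrite !filter_uniq ?iota_uniq.
move=> c; rewrite !mem_filter mem_iota /=; case cB: (c \in B); rewrite /= ?andbF //.
by have := row_mem rB cB; rewrite add1n ltnS => ->; rewrite andbT.
Qed.

Section Estar.
Variables (n : nat) (X B : seq nat).
Hypotheses (rX : row n X) (rB : row n B).
Let U := (mopen (mem B) (mem X) (iota 1 n)).1.
Let X' := sort leq (X ++ rev U).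
Let B' := [seq c <- B | c \notin rev U].

Let uU : uniq U.
Proof. exact: subseq_uniq (mopen_subseq _ _ _) (iota_uniq _ _). Qed.

Let UB c : c \in U -> [&& c \in B, c \notin X & 0 < c <= n].
Proof. by move/mopen_sub; rewrite !inE mem_iota /= add1n ltnS. Qed.

Lemma estar_row_lower : row n X'.
Proof.
have hu : uniq X'.
  rewrite sort_uniq cat_uniq rev_uniq uU (row_uniq rX) /= andbT.
  by apply/hasPn => c; rewrite mem_rev => /UB /and3P [].
rewrite /row ltn_sorted_uniq_leq hu sort_sorted; last exact: leq_total.
apply/allP => c; rewrite mem_sort mem_cat mem_rev => /orP [/(row_mem rX) //|/UB /and3P [] //].
Qed.

Lemma estar_row_upper : row n B'.
Proof.
case/andP: (rB) => sB aB; rewrite /row sorted_filter //=; last exact: ltn_trans.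
by apply/allP => c; rewrite mem_filter => /andP [_]; apply: row_mem rB.
Qed.

Lemma estar_perm_upper : perm_eq (B' ++ U) B.
Proof.
have /permPl h := perm_filterC (fun c => c \notin rev U) B.
apply: perm_trans h; rewrite perm_cat2l.
apply: uniq_perm => //; first by rewrite filter_uniq // (row_uniq rB).
move=> c; rewrite mem_filter /= mem_rev negbK.
by case cU: (c \in U) => //=; have /and3P [->] := UB cU.
Qed.

Lemma estar_perm : perm_eq (X' ++ B') (X ++ B).
Proof.
have /permP h := estar_perm_upper; apply/permP => a.
by move: (h a); rewrite !count_cat count_sort count_cat count_rev; lia.
Qed.

(** Each word is equivalent to its [outs] followed by its [puts]. The [outs] agree by [mclose_flip];
    hence so do the [puts], being increasing arrangements of the same remaining letters. *)
Lemma estar_pleq : pleq (X' ++ B') (X ++ B).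
Proof.
have eD : outs X' B' = outs X B.
  rewrite (outs_mclose estar_row_lower estar_row_upper) (outs_mclose rX rB).
  rewrite [RHS](mclose_flip _ _ _ (iota_uniq _ _)) min0n.
  apply: eq_mclose => c _ /=; first by rewrite mem_filter mem_rev andbC.
  by rewrite mem_sort mem_cat mem_rev.
have eP : puts X' B' = puts X B.
  apply: (sorted_eq leq_trans anti_leq).
  - by apply: (sub_sorted ltnW); apply: puts_sorted; apply: row_sorted estar_row_lower.
  - by apply: (sub_sorted ltnW); apply: puts_sorted; apply: row_sorted rX.
  have /permP h1 := perm_puts B' (row_sorted estar_row_lower).
  have /permP h2 := perm_puts B (row_sorted rX).
  have /permP h3 := estar_perm.
  by apply/permP => a; move: (h1 a) (h2 a) (h3 a); rewrite eD !count_cat; lia.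
apply: pleq_trans (pleq_puts B' (row_sorted estar_row_lower)) _.
by rewrite eD eP => C hC; rewrite (pleq_puts B (row_sorted rX)).
Qed.

Let suf x := [seq c <- iota 1 n | x <= c].

(** The scan [mopen] runs from the right, so what it leaves unmatched from [x] on depends only on
    the columns from [x] on. *)
Lemma count_mopen x : count (leq x) U = size (mopen (mem B) (mem X) (suf x)).1.
Proof.
have [V eV hV] := mopen_cat (mem B) (mem X) [seq c <- iota 1 n | c < x] (suf x).
rewrite /U {1}(filter_ltn_cat x (iota_ltn_sorted 1 n)) eV count_cat.
rewrite (@eq_in_count _ _ pred0) => [|c /hV]; last by rewrite mem_filter /=; lia.
rewrite count_pred0; apply/eqP; rewrite -all_count; apply/allP => c /mopen_sub.
by rewrite !inE mem_filter => /and4P [].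
Qed.

Lemma count_estar x : count (leq x) B' + size (mopen (mem B) (mem X) (suf x)).1 = count (leq x) B.
Proof. by rewrite -count_mopen -count_cat; apply/permP; exact: estar_perm_upper. Qed.

(** A ball that stays is matched with a ball of [X] weakly to its right; [mopen_count] counts these
    pairs in each suffix. *)
Lemma estar_dom : dom B' X.
Proof.
move=> x; rewrite (row_count (leq x) rX).
move: (count_estar x) (mopen_count (mem B) (mem X) (suf x)).
rewrite (row_count (leq x) rB) -/(suf x) => <-.
by rewrite [_ + size _]addnC -addnA => /addnI ->; exact: leq_addr.
Qed.

(** The bracketing is maximum on every suffix. This keeps the next higher row dominated when the
    upper row loses balls. *)
Lemma estar_max Y : row n Y -> {subset Y <= B} -> dom Y X -> dom Y B'.
Proof.
move=> rY sYB hY x.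
suff : count (mem Y) (suf x) + size (mopen (mem B) (mem X) (suf x)).1 <= count (mem B) (suf x).
  by move: (count_estar x); rewrite (row_count (leq x) rB) (row_count (leq x) rY) -/(suf x); lia.
apply: mopen_max => [c _ /sYB //|cs1 [|a cs2] // e].
(* A nonempty suffix starting at column [a] is [suf a], where the condition is [dom Y X] at [a]. *)
have e2 : a :: cs2 = suf a.
  have s1 := iota_ltn_sorted 1 n; have e3 := filter_ltn_cat x s1.
  move: s1; rewrite /suf e3 -/(suf x) e catA sorted_cat_ltn => /and3P [_ s2 /allrelP s3].
  rewrite filter_cat (@eq_in_filter _ _ pred0) ?filter_pred0; last first.
    by move=> y yp; have := s3 y a yp (mem_head _ _) => /=; lia.
  apply/esym/all_filterP; rewrite /= leqnn /=.
  by apply: sub_all (order_path_min ltn_trans s2) => y /=; lia.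
by rewrite e2 -(row_count (leq a) rY) -(row_count (leq a) rX).
Qed.
End Estar.

Lemma dom_nil X : dom [::] X.
Proof. by []. Qed.

Lemma row_nth n B k : all (row n) B -> row n (nth [::] B k).
Proof.
move=> h; case: (ltnP k (size B)) => hk; last by rewrite nth_default.
exact: (allP h) (mem_nth _ hk).
Qed.

Lemma set_nth2 (B : seq (seq nat)) i X Y : i.+1 < size B ->
  set_nth [::] (set_nth [::] B i X) i.+1 Y = take i B ++ [:: X, Y & drop i.+2 B].
Proof.
elim: i B => [|i IH] [|b B] //= h; last by rewrite -IH.
by case: B h => //= b' B _; rewrite drop0.
Qed.

Lemma cat_take_drop2 (B : seq (seq nat)) i : i.+1 < size B ->
  B = take i B ++ [:: nth [::] B i, nth [::] B i.+1 & drop i.+2 B].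
Proof.
move=> h; rewrite -{1}(cat_take_drop i B) (drop_nth [::]) ?(drop_nth [::] h) //.
exact: ltnW.
Qed.

(** List positions start at 0, so the operator of index [i.+1] moves balls from position [i.+1] to
    position [i]. *)
Lemma e_starP n i B : all (row n) B -> i.+1 < size B ->
  let B2 := e_star n i.+1 B in
  let X := nth [::] B i in let Z := nth [::] B i.+1 in
  [/\ size B2 = size B, all (row n) B2, pleq (flatten B2) (flatten B),
      forall k, k != i -> k != i.+1 -> nth [::] B2 k = nth [::] B k &
      [/\ {subset X <= nth [::] B2 i}, dom (nth [::] B2 i.+1) X &
          forall Y, row n Y -> {subset Y <= Z} -> dom Y X -> dom Y (nth [::] B2 i.+1)]].
Proof.
move=> rB hi B2 X Z.
have rX : row n X by apply: row_nth.
have rZ : row n Z by apply: row_nth.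
pose U := (mopen (mem Z) (mem X) (iota 1 n)).1.
pose X' := sort leq (X ++ rev U); pose Z' := [seq c <- Z | c \notin rev U].
have e : B2 = take i B ++ [:: X', Z' & drop i.+2 B].
  by rewrite /B2 /e_star unmatched_mopen //= set_nth2.
have hn k : nth [::] B2 k = if k == i then X' else if k == i.+1 then Z' else nth [::] B k.
  rewrite /B2 /e_star unmatched_mopen //= !nth_set_nth /= nth_set_nth /=.
  by case: eqP => [->|_]; case: eqP => //; lia.
have eB := cat_take_drop2 hi.
split.
- by rewrite e [in RHS]eB !size_cat.
- move: rB; rewrite {1}eB e !all_cat /= => /and4P [-> _ _ ->].
  by rewrite estar_row_lower // estar_row_upper.
- rewrite e [in X in pleq _ X]eB !flatten_cat /= !catA -!catA.
  have := @pleq_ctx (flatten (take i B)) (flatten (drop i.+2 B)) _ _ (estar_pleq rX rZ).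
  by rewrite -!catA.
- by move=> k /negbTE h1 /negbTE h2; rewrite hn h1 h2.
rewrite !hn eqxx (_ : (i.+1 == i) = false) ?eqxx; last by lia.
split.
- by move=> c cX; rewrite mem_sort mem_cat cX.
- exact: estar_dom.
- by move=> Y rY sY dY; apply: estar_max.
Qed.

(* While [e_i^*] descends, row [i] only gains balls; the witness [Y] is its content
   before the gain, which was already matched with both neighbours. *)
Lemma e_star_intP n m i B : all (row n) B -> i <= m -> m < size B ->
  (forall k, k.+1 < i -> dom (nth [::] B k.+1) (nth [::] B k)) ->
  (exists Y, [/\ row n Y, {subset Y <= nth [::] B i},
     0 < i -> dom Y (nth [::] B i.-1) & i < m -> dom (nth [::] B i.+1) Y]) ->
  (forall k, i < k < m -> dom (nth [::] B k.+1) (nth [::] B k)) ->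
  let B2 := e_star_int n i B in
  [/\ size B2 = size B, all (row n) B2, pleq (flatten B2) (flatten B) &
      forall k, k < m -> dom (nth [::] B2 k.+1) (nth [::] B2 k)].
Proof.
elim: i B => [|i IH] B rB im mB h1 [Y [rY sY h2 h3]] h4.
  split=> // -[|k] hk; last exact: h4.
  exact: dom_trans (h3 hk) (dom_sub rY sY).
have [s1 r1 p1 n1 [sX dX mX]] := e_starP rB (leq_ltn_trans im mB).
move=> B2.
have -> : B2 = e_star_int n i (e_star n i.+1 B).
  by rewrite /B2 /e_star_int -[in X in rev (iota 1 X)]addn1 iotaD rev_cat /= add1n.
have [||||s2 r2 p2 d2] := IH _ r1 (ltnW im).
- by rewrite s1.
- move=> k hk; rewrite !n1; try lia.
  by apply: h1; lia.
- exists (nth [::] B i); split=> //; first exact: row_nth.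
  case: i {IH im rY Y sY h2 h3 h4 s1 r1 p1 sX dX mX B2} h1 n1 => // i h1 n1 _.
  by rewrite n1 /=; [apply: h1 | lia | lia].
(* Row [i.+1] has lost balls, but [Y] is dominated by row [i], hence by what remains; row [i.+2] is
   dominated by [Y]. *)
- move=> k /andP [ik km]; case: (eqVneq k i.+1) => [ek|nk].
    subst k; rewrite n1; [|lia|lia].
    exact: dom_trans (h3 km) (mX _ rY sY (h2 isT)).
  by rewrite !n1; [apply: h4|..]; lia.
split=> //; first by rewrite s2.
exact: pleq_trans p2 p1.
Qed.

(* Rows past the top are empty, so [k] needs no bound. *)
Definition chain (M : seq (seq nat)) := forall k, dom (nth [::] M k.+1) (nth [::] M k).

Lemma rhoP n w : all (fun x => 0 < x <= n) w ->
  [/\ all (row n) (rho n w), chain (rho n w) & pleq (rw (rho n w)) w].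
Proof.
move=> hw; rewrite /rho /rhoN size_map; set B0 := map _ w.
have s0 : size B0 = size w by rewrite size_map.
have r0 : all (row n) B0.
  by rewrite all_map; apply: sub_all hw => x /= hx; rewrite /row /= hx.
have f0 : flatten B0 = w by rewrite flatten_seq1.
(* After [j] rounds each of the lowest [j.+1] rows is dominated by the one below it; [maxn 1] admits
   the empty word. *)
suff h r j B : all (row n) B -> j + r < maxn 1 (size B) ->
    (forall k, k < j -> dom (nth [::] B k.+1) (nth [::] B k)) ->
    let B2 := foldl (fun B j => e_star_int n j B) B (iota j.+1 r) in
    [/\ size B2 = size B, all (row n) B2, pleq (flatten B2) (flatten B) &
      forall k, k < j + r -> dom (nth [::] B2 k.+1) (nth [::] B2 k)].
  have [|//|s2 r2 p2 d2] := h (size w).-1 0 B0 r0; first by rewrite s0; lia.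
  split=> //; last by rewrite /rw -{2}f0.
  move=> k; case: (ltnP k (0 + (size w).-1)) => hk; first exact: d2.
  by rewrite nth_default ?s2 ?s0; [exact: dom_nil | lia].
elim: r j B => [|r IH] j B rB hj hB.
  by split=> //; rewrite addn0.
have [|||||s1 r1 p1 d1] := @e_star_intP n j.+1 j.+1 B rB.
- by [].
- lia.
- by move=> k hk; apply: hB.
(* Nothing is known yet about the row that joins, so the witness is empty. *)
- by exists [::]; split=> //; lia.
- by move=> k; lia.
have [|//|s2 r2 p2 d2] := IH j.+1 _ r1; first by rewrite s1; lia.
split=> //=; first by rewrite s2.
- exact: pleq_trans p2 p1.
- by move=> k; rewrite addnS => hk; apply: d2; rewrite addSn.
Qed.

(** * Shapes of insertion tableaux *)

Lemma mclose_cat p q h cs1 cs2 : exists h',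
  mclose p q h (cs1 ++ cs2) = mclose p q h cs1 ++ mclose p q h' cs2.
Proof.
elim: cs1 h => [|c cs IH] h; first by exists h.
rewrite /=; case: (q c); last exact: IH.
case: (p c + h) => [|k]; first exact: IH.
by have [h' ->] := IH k; exists h'.
Qed.

Lemma mclose_subseq p q h cs : subseq (mclose p q h cs) [seq c <- cs | q c].
Proof.
elim: cs h => //= c cs IH h; case: ifP => _; last exact: IH.
case: (p c + h) => [|k]; last by rewrite /= eqxx IH.
exact: subseq_trans (IH _) (subseq_cons _ _).
Qed.

Lemma mclose_ub p q h cs : size (mclose p q h cs) <= h + count p cs.
Proof.
elim: cs h => //= c cs IH h; case: (q c).
  case E: (p c + h) => [|k] /=; first by have := IH 0; lia.
  by have := IH k; lia.
by have := IH (p c + h); lia.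
Qed.

(** Cut just after the last unmatched closing bracket: nothing is pending there, so all earlier
    opening brackets have been closed, and all later closing brackets are matched. *)
Lemma mclose_lb p q h cs :
  size (mclose p q h cs) = count q cs \/
  exists cs1 cs2, cs = cs1 ++ cs2 /\
    h + count p cs1 + count q cs2 <= size (mclose p q h cs).
Proof.
elim: cs h => [|c cs IH] h /=; first by left.
case qc: (q c).
  case E: (p c + h) => [|k] /=.
    right; case: (IH 0) => [->|[cs1 [cs2 [-> h1]]]].
      by exists [:: c], cs; split=> //=; lia.
    by exists (c :: cs1), cs2; split=> //=; lia.
  case: (IH k) => [->|[cs1 [cs2 [-> h1]]]]; first by left; lia.
  by right; exists (c :: cs1), cs2; split=> //=; lia.
case: (IH (p c + h)) => [->|[cs1 [cs2 [-> h1]]]]; first by left; lia.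
by right; exists (c :: cs1), cs2; split=> //=; lia.
Qed.

Lemma filter_gtn_prefix n x cs1 cs2 : [seq c <- iota 1 n | gtn x c] = cs1 ++ cs2 ->
  exists2 y, y <= x & cs1 = [seq c <- iota 1 n | gtn y c].
Proof.
case: cs2 => [|a cs2] e; first by exists x; rewrite // e cats0.
have ax : a < x.
  have : a \in [seq c <- iota 1 n | gtn x c] by rewrite e mem_cat mem_head orbT.
  by rewrite mem_filter => /andP [].
exists a; first exact: ltnW.
have s : sorted ltn (cs1 ++ a :: cs2).
  by rewrite -e; apply: sorted_filter; [exact: ltn_trans | exact: iota_ltn_sorted].
have -> : [seq c <- iota 1 n | gtn a c] = [seq c <- [seq c <- iota 1 n | gtn x c] | gtn a c].
  by rewrite -filter_predI; apply: eq_filter => c /=; lia.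
move: s; rewrite e filter_cat sorted_cat_ltn => /and3P [_ s2 /allrelP s3].
rewrite (@eq_in_filter _ _ predT cs1) ?filter_predT; last first.
  by move=> y yc; apply: s3 => //; exact: mem_head.
rewrite (@eq_in_filter _ _ pred0 (a :: cs2)) ?filter_pred0 ?cats0 //.
move=> y; rewrite inE => /orP [/eqP ->|yc] /=; first by lia.
by move: (order_path_min ltn_trans s2) => /allP /(_ _ yc) /=; lia.
Qed.

Lemma count_gtn_leq (L : seq nat) x : count (gtn x) L + count (leq x) L = size L.
Proof.
rewrite -(count_predC (gtn x)); congr (_ + _); apply: eq_count => y /=; lia.
Qed.

Lemma row_outs n X B : row n X -> row n B -> row n (outs X B) /\ {subset outs X B <= X}.
Proof.
move=> rX rB; rewrite (outs_mclose rX rB).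
have h := mclose_subseq (mem B) (mem X) 0 (iota 1 n).
split; last by move=> c /(mem_subseq h); rewrite mem_filter => /andP [].
rewrite /row (subseq_sorted ltn_trans h) /=; last first.
  by apply: sorted_filter; [exact: ltn_trans | exact: iota_ltn_sorted].
by apply/allP => c /(mem_subseq h); rewrite mem_filter mem_iota; lia.
Qed.

(* With [d], [b], [a] counting the letters [< x] of [D = outs X B], [B] and [X],
   one has [d x = min_(y <= x) (b y + a x - a y)]. *)
Section OneColumn.
Variables (n : nat) (X B : seq nat).
Hypotheses (rX : row n X) (rB : row n B).
Notation D := (outs X B).

Lemma count_outs x : count (gtn x) D =
  size (mclose (mem B) (mem X) 0 [seq c <- iota 1 n | gtn x c]).
Proof.
rewrite (outs_mclose rX rB) {1}(filter_ltn_cat x (iota_ltn_sorted 1 n)).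
have [h ->] := mclose_cat (mem B) (mem X) 0 [seq c <- iota 1 n | c < x] [seq c <- iota 1 n | x <= c].
rewrite count_cat [X in _ + X](@eq_in_count _ _ pred0) => [|c]; last first.
  move/(mem_subseq (mclose_subseq _ _ _ _)); rewrite !mem_filter /=; lia.
rewrite count_pred0 addn0; apply/eqP; rewrite -all_count; apply/allP => c.
by move/(mem_subseq (mclose_subseq _ _ _ _)); rewrite !mem_filter /=; lia.
Qed.

Lemma count_outs_ub x : count (gtn x) D <= count (gtn x) B.
Proof. by rewrite count_outs (row_count (gtn x) rB); apply: mclose_ub. Qed.

Lemma count_outs_lb x : exists2 y, y <= x &
  count (gtn y) B + count (gtn x) X <= count (gtn x) D + count (gtn y) X.
Proof.
rewrite count_outs; case: (mclose_lb (mem B) (mem X) 0 [seq c <- iota 1 n | gtn x c]).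
  move=> ->; exists 0 => //; rewrite -(row_count (gtn x) rX).
  by rewrite !(@eq_count _ (gtn 0) pred0) // !count_pred0 addn0.
case=> cs1 [cs2 [e h]]; have [y yx e1] := filter_gtn_prefix e.
exists y => //; rewrite (row_count (gtn y) rB) (row_count (gtn y) rX) (row_count (gtn x) rX).
rewrite e count_cat -e1 addnA [X in _ <= X]addnC [_ + count (mem X) cs1]addnC -addnA leq_add2l.
by rewrite -e.
Qed.

Lemma count_outs_mid y x : y <= x ->
  count (gtn x) D + count (gtn y) X <= count (gtn x) X + count (gtn y) D.
Proof.
move=> yx; have [rD sD] := row_outs rX rB.
have h L : count (gtn x) L = count (gtn y) L + count (fun c => y <= c < x) L.
  by elim: L => //= c L ->; lia.
have : count (fun c => y <= c < x) D <= count (fun c => y <= c < x) X.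
  rewrite -!size_filter; apply: uniq_leq_size; first by rewrite filter_uniq // (row_uniq rD).
  by move=> c; rewrite !mem_filter => /andP [-> /sD].
by move: (h D) (h X); lia.
Qed.

Lemma count_puts a : count a (puts X B) + count a D = count a X + count a B.
Proof. by rewrite -!count_cat; apply/permP; apply: perm_puts; apply: row_sorted rX. Qed.

(** Evaluate the lower bound of [count_outs_lb] at [n.+1], beyond all letters, and use [dom B X] at
    the resulting [y]. *)
Lemma size_outs_dom : dom B X -> size D = size B.
Proof.
move=> dBX; apply/eqP; rewrite eqn_leq size_outs /=.
have [rD _] := row_outs rX rB.
have big L : row n L -> count (gtn n.+1) L = size L.
  by move=> rL; apply/eqP; rewrite -all_count; apply/allP => c /(row_mem rL) /=; lia.
have [y _] := count_outs_lb n.+1; rewrite !big //.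
by move: (dBX y) (count_gtn_leq B y) (count_gtn_leq X y); lia.
Qed.

End OneColumn.

Lemma dom_puts n A B C : row n A -> row n B -> dom C B -> dom C (puts A B).
Proof.
move=> rA rB dCB x; apply: leq_trans (dCB x) _.
have [rD sD] := row_outs rA rB.
by move: (count_puts B rA (leq x)) (dom_sub rD sD x); lia.
Qed.

(** For [C] passing through [puts A B], [count_outs_lb] gives a cut [y <= x]. Rewriting the counts
    of [puts A B] through [A], [B] and [outs A B], the claim is a linear combination of [dom C B] at
    [y], [count_outs_ub] at [x] and [count_outs_mid]. *)
Lemma dom_outs n A B C : row n A -> row n B -> row n C -> dom B A -> dom C B ->
  dom (outs (puts A B) C) (outs A B).
Proof.
move=> rA rB rC dBA dCB x.
have rA' : row n (puts A B) by apply: row_puts => //; case/andP: rB.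
have sE := size_outs_dom rA' rC (dom_puts rA rB dCB).
have sD := size_outs_dom rA rB dBA.
have [y yx lb] := count_outs_lb rA' rC x.
move: (count_gtn_leq (outs (puts A B) C) x) (count_gtn_leq (outs A B) x).
move: (count_gtn_leq B y) (count_gtn_leq C y) (dCB y) lb (count_puts B rA (gtn x)) (count_puts B rA (gtn y)).
move: (count_outs_ub rA rB x) (count_outs_mid rA rB yx).
by lia.
Qed.

Fixpoint outrows (c : seq nat) (M : seq (seq nat)) :=
  if M is B :: M' then outs c B :: outrows (puts c B) M' else [::].

Lemma flatten_outrows c M : flatten (outrows c M) = outs c (flatten M).
Proof. by elim: M c => //= B M IH c; rewrite IH outs_cat. Qed.

Lemma chain_cons B M : chain (B :: M) -> chain M.
Proof. by move=> h k; exact: (h k.+1). Qed.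

(** Each row bumps as many letters as it has, so the column keeps its length; by [dom_puts] the
    changed column still dominates the next row. *)
Lemma outrowsP n c M : row n c -> all (row n) M -> chain (c :: M) ->
  [/\ all (row n) (outrows c M), chain (outrows c M),
      map size (outrows c M) = map size M & size (puts c (flatten M)) = size c].
Proof.
elim: M c => [|B M IH] c rc //= /andP [rB rM] ch.
have dB : dom B c := ch 0.
have sD := size_outs_dom rc rB dB.
have rA : row n (puts c B) by apply: row_puts => //; case/andP: rB.
have [|i1 i2 i3 i4] := IH _ rA rM.
  case=> [|k]; last exact: (ch k.+2).
  by apply: (dom_puts rc rB); exact: (ch 1).
split.
- by rewrite i1 andbT; case: (row_outs rc rB).
- case=> [|k]; last exact: i2.
  case: M {IH i1 i2 i3 i4} rM ch => [|C M] //= /andP [rC _] ch.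
  exact: (dom_outs rc rB rC dB (ch 1)).
- by rewrite sD i3.
- rewrite /puts foldl_cat -/puts i4.
  have /perm_size := perm_puts B (row_sorted rc).
  by rewrite !size_cat sD => /addIn.
Qed.

Lemma chain_nil M : chain ([::] :: M) -> flatten M = [::].
Proof.
elim: M => //= B M IH ch; have /dom_size := ch 0.
by rewrite leqn0 size_eq0 => /eqP /= e; subst B; apply: IH; apply: chain_cons ch.
Qed.

(** The first row becomes the first column without bumping. The others pass through it, leaving its
    length unchanged, and bump out a chain of the same sizes, to which induction applies. Empty rows
    open no column. *)
Lemma ins_shape n M : all (row n) M -> chain M ->
  map size (ins [::] (flatten M)) = [seq k <- map size M | 0 < k].
Proof.
have [N] := ubnP (size M); elim: N M => // N IH [|B M] //= h /andP [rB rM] ch.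
case: B rB ch => [|b B] rB ch.
  have e := chain_nil ch; rewrite /= e /=.
  elim: M e {h ch rM} => //= C M IHM; case: C => //= /IHM <- //.
have e1 w : ins [::] (b :: B ++ w) = ins [:: b :: B] w.
  rewrite -cat_cons ins_cat; congr ins.
  rewrite -[LHS]/(ins [:: [:: b]] B) ins_cons.
  have [-> ->] : puts [:: b] B = b :: B /\ outs [:: b] B = [::].
    suff h' c : sorted ltn (c ++ B) -> puts c B = c ++ B /\ outs c B = [::].
      by apply: (h' [:: b]); case/andP: rB.
    elim: B c {rB ch h} => [|x B IHB] c; first by rewrite cats0.
    rewrite -cat_rcons => hs /=.
    have hx : all (gtn x) c.
      move: hs; rewrite cat_rcons sorted_cat_ltn => /and3P [_ _ /allrelP s3].
      by apply/allP => y yc; apply: s3 => //; exact: mem_head.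
    have [e1 e2] := cput_split hx (leqnn (head x [::])).
    rewrite cats0 in e1 e2; rewrite e1 e2 cats1 /=.
    by have [-> ->] := IHB _ hs.
  by [].
rewrite cat_cons e1 ins_cons /=.
have [r1 c1 s1 ->] := outrowsP rB rM ch.
by rewrite -flatten_outrows IH // -?s1 // -(size_map size) s1 size_map; move: h => /=; lia.
Qed.

(** * Inverting column insertion *)

Lemma filter_none (a : pred nat) s : all (predC a) s -> filter a s = [::].
Proof.
rewrite all_predC has_count -leqNgt leqn0 => /eqP h.
by apply/eqP; rewrite -size_eq0 size_filter h.
Qed.

Lemma cat_le_gt (p t : seq nat) x y : all (gtn x) p -> x <= y -> all (ltn y) t ->
  [seq z <- p ++ x :: t | z <= y] = rcons p x /\ [seq z <- p ++ x :: t | y < z] = t.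
Proof.
move=> hp xy ht; rewrite !filter_cat /= xy ltnNge xy /= -cats1.
rewrite [filter _ t in LHS]filter_none; last by apply: sub_all ht => z /=; lia.
rewrite [[seq z <- p | y < z]]filter_none; last by apply: sub_all hp => z /=; lia.
by split; [congr (_ ++ _)|]; apply/all_filterP => //; apply: sub_all hp => z /=; lia.
Qed.

(** Reverse bumping: the inserted letter is the largest one of the new column not exceeding the
    bumped letter, or the top one if nothing was bumped. *)
Lemma cput_inj c c' x x' : sorted ltn c -> sorted ltn c' ->
  cput c x = cput c' x' -> cout c x = cout c' x' -> c = c' /\ x = x'.
Proof.
move=> sc sc'; have [p [s [e hp hs]]] := sorted_split x sc; subst c.
have [p' [s' [e hp' hs']]] := sorted_split x' sc'; subst c'.
have hx : x <= head x s by case: s hs {sc} => //= a s /andP [].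
have hx' : x' <= head x' s' by case: s' hs' {sc'} => //= a s' /andP [].
rewrite !(cput_split hp hx) !(cput_split hp' hx').
case: s s' sc sc' hx hx' {hs hs'} => [|y t] [|y' t'] sc sc' /= hx hx' //.
  by rewrite !cats1 !cats0 => /rcons_inj [-> ->].
rewrite !take0 => e [ey]; subst y'.
have gt q u : sorted ltn (q ++ y :: u) -> all (ltn y) u.
  by rewrite sorted_cat_ltn => /and3P [_ /(order_path_min ltn_trans)].
have [e1 e2] := cat_le_gt hp hx (gt _ _ sc).
have [e1' e2'] := cat_le_gt hp' hx' (gt _ _ sc').
move: e1 e2; rewrite e e1' e2' => /rcons_inj [-> ->] ->.
by [].
Qed.

Lemma cout_nil_or_one c x : cout c x = [::] \/ exists2 y, cout c x = [:: y] & y \in c.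
Proof.
rewrite /cout; case E: (drop _ c) => [|y s]; first by left.
by right; exists y; rewrite /= ?take0 //; apply: (mem_drop (n0 := find (leq x) c)); rewrite E mem_head.
Qed.

(** Equal shapes before and after force both insertions to end in the same column, so every column
    bumps in both or in neither. *)
Lemma cinsert_inj C C' x x' : all (sorted ltn) C -> all (sorted ltn) C' ->
  map size C = map size C' -> cinsert x C = cinsert x' C' -> C = C' /\ x = x'.
Proof.
elim: C C' x x' => [|c C IH] [|c' C'] x x' //; first by move=> _ _ _ [->].
move=> /andP [sc sC] /andP [sc' sC'] [ec eC]; rewrite !cinsert_cons => -[e1 e2].
have := perm_size (perm_cput x sc); have := perm_size (perm_cput x' sc').
rewrite !size_cat !size_rcons e1 ec.
case: (cout_nil_or_one c x) e2 => [e|[y e _]]; case: (cout_nil_or_one c' x') => [e'|[y' e' _]];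
  rewrite e e' /= => e2; try lia.
  by move=> _ _; have [-> ->] := cput_inj sc sc' e1 (etrans e (esym e')); rewrite e2.
have [-> ey] := IH _ _ _ sC sC' eC e2; subst y'.
by move=> _ _; have [-> ->] := cput_inj sc sc' e1 (etrans e (esym e')).
Qed.

(** The sequence of shapes acts as a recording tableau: it tells where the last insertion ended,
    which can then be undone. *)
Lemma ins_inj w w' : size w = size w' ->
  (forall k, k <= size w ->
     map size (ins [::] (take k w)) = map size (ins [::] (take k w'))) ->
  ins [::] w = ins [::] w' -> w = w'.
Proof.
elim/last_ind: w w' => [|u x IH] w'; first by case: w'.
case/lastP: w' => [|u' x']; first by rewrite size_rcons.
rewrite !size_rcons => -[su] h e.
have hk k : k <= size u -> map size (ins [::] (take k u)) = map size (ins [::] (take k u')).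
  move=> hk; have := h k (leqW hk).
  by rewrite -!cats1 !takel_cat // -su.
have hu := hk _ (leqnn _); rewrite {2}su !take_size in hu.
move: e; rewrite -!cats1 !ins_cat /= => /(cinsert_inj (ins_sorted _ _) (ins_sorted _ _)).
by move=> /(_ isT isT hu) [/(IH _ su hk) -> ->].
Qed.

(** Cuts the row word after [k] letters but keeps its division into rows, so that [ins_shape]
    applies to prefixes. *)
Fixpoint takerows k (M : seq (seq nat)) :=
  if M is B :: M' then take k B :: takerows (k - size B) M' else [::].

Lemma flatten_takerows k M : flatten (takerows k M) = take k (flatten M).
Proof.
elim: M k => //= B M IH k; rewrite IH take_cat.
by case: ltnP => h //; rewrite (eqP (ltnW h)) take0 cats0 // || rewrite take_oversize.
Qed.

Lemma size_takerows k M M' : map size M = map size M' ->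
  map size (takerows k M) = map size (takerows k M').
Proof.
elim: M M' k => [|B M IH] [|B' M'] k //= [eB eM].
by rewrite !size_take eB (IH M').
Qed.

Lemma row_take n k B : row n B -> row n (take k B).
Proof.
case/andP => sB /allP aB; rewrite /row take_sorted //=.
by apply/allP => c /mem_take /aB.
Qed.

(** A row above one that is cut becomes empty; a row above a full one only shrinks. *)
Lemma takerowsP n k M : all (row n) M -> chain M ->
  all (row n) (takerows k M) /\ chain (takerows k M).
Proof.
elim: M k => // B M IH k /= /andP [rB rM] ch.
have [-> ch2] := IH (k - size B) rM (chain_cons ch); rewrite row_take //; split=> // -[|j]; last exact: ch2.
case: M {IH ch2} rM ch => //= C M /andP [rC _] ch.
case: (leqP (size B) k) => h.
  rewrite [take k B]take_oversize //.
  apply: dom_trans (ch 0); apply: (dom_sub (row_take _ rC)) => c; exact: mem_take.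
by rewrite (eqP (ltnW h)) take0.
Qed.

Lemma chain_inj n M M' : all (row n) M -> all (row n) M' -> chain M -> chain M' ->
  map size M = map size M' ->
  ins [::] (flatten M) = ins [::] (flatten M') -> M = M'.
Proof.
move=> rM rM' cM cM' es e; apply: eq_from_flatten_shape => //.
apply: ins_inj => //; first by rewrite !size_flatten /shape es.
move=> k _; rewrite -!flatten_takerows.
have [r1 c1] := takerowsP k rM cM; have [r2 c2] := takerowsP k rM' cM'.
by rewrite (ins_shape r1 c1) (ins_shape r2 c2) (size_takerows k es).
Qed.

(** * Semistandardness of the insertion tableau, and reading words *)

Definition lecol (c c' : seq nat) := forall t, count (gtn t) c' <= count (gtn t) c.
Definition adjacent (C : seq (seq nat)) := forall j, lecol (nth [::] C j) (nth [::] C j.+1).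

(** In [c] a letter [y >= x] is traded for [x], which lowers no count. In [c'] the gain of [y]
    matters only for [t > y], where it is offset if the letter bumped from [c'] is also below
    [t]. *)
Lemma lecol_cput c c' x : sorted ltn c -> sorted ltn c' -> lecol c c' ->
  lecol (cput c x) (puts c' (cout c x)).
Proof.
move=> sc sc' h t; have /permP /(_ (gtn t)) := perm_cput x sc.
rewrite count_cat -cats1 count_cat /= addn0 => e1; have ht := h t.
have xy y : cout c x = [:: y] -> x <= y.
  have [p [s [e hp hs]]] := sorted_split x sc; subst c.
  have hx : x <= head x s by case: s hs {sc e1 h ht} => //= a s /andP [].
  by rewrite (cput_split hp hx); case: s hx {sc e1 hs h ht} => //= a s xa []; rewrite take0 => <-.
case: (cout_nil_or_one c x) xy e1 => [->|[y -> yc /(_ y erefl) xy]] /=; first by lia.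
have [p [s [e hp hs]]] := sorted_split y sc'; subst c'.
have hy : y <= head y s by case: s hs {sc' h ht} => //= a s /andP [].
rewrite (cput_split hp hy) addn0.
have cpy : count (gtn y) (p ++ s) = size p.
  rewrite count_cat (eqP (_ : count (gtn y) p == size p)) -?all_count //.
  rewrite (@eq_in_count _ _ pred0) ?count_pred0 ?addn0 // => z zs /=.
  by move/allP: hs => /(_ z zs); lia.
(* Otherwise there is room: as [y] lies in [c], the counts of [c] rise strictly past [y]. *)
have cyt : y < t -> count (gtn y) c < count (gtn t) c.
  move=> yt; rewrite -!size_filter.
  have : size [seq z <- c | z <= y] <= size [seq z <- c | gtn t z].
    apply: uniq_leq_size; first by rewrite filter_uniq // (sorted_uniq ltn_trans ltnn).
    by move=> z; rewrite !mem_filter /= => /andP [zy ->]; rewrite andbT; lia.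
  apply: leq_trans; rewrite !size_filter.
  have -> : count (fun z => z <= y) c = count (gtn y) c + count (pred1 y) c.
    by elim: (c) => //= a l ->; rewrite -[a == y]/(a == y); lia.
  by rewrite -[X in X < _]addn0 ltn_add2l -has_count has_pred1.
move: (h y) ht; rewrite cpy; case: s sc' {hs cpy h} hy => [|y' s] sc' /= hy.
  by rewrite !count_cat /=; have := count_size (gtn t) p; lia.
rewrite !count_cat /=.
have : y' < t \/ count (gtn t) s = 0.
  case: (ltnP y' t) => h; [by left | right].
  move: sc'; rewrite sorted_cat_ltn => /and3P [_ /= /(order_path_min ltn_trans) /allP h2 _].
  by rewrite (@eq_in_count _ _ pred0) ?count_pred0 // => z /h2 /=; lia.
by have := count_size (gtn t) p; case: (ltnP y' t); lia.
Qed.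

Lemma adjacent_cinsert C x : all (sorted ltn) C -> adjacent C -> adjacent (cinsert x C).
Proof.
elim: C x => [|c C IH] x; first by move=> _ _ [|[|k]].
move=> /= /andP [sc sC] h; rewrite -/(cinsert x (c :: C)) cinsert_cons.
have hC : adjacent C by move=> k; exact: (h k.+1).
have e : nth [::] (ins C (cout c x)) 0 = puts (nth [::] C 0) (cout c x).
  case: (cout_nil_or_one c x) => [->|[y -> _]] //=.
  by case: (C) => [|c' C'] //; rewrite cinsert_cons.
case=> [|k] /=.
  by rewrite e; apply: lecol_cput (h 0) => //; case: (C) sC => //= ? ? /andP [].
by case: (cout_nil_or_one c x) => [->|[y -> _]] //=; exact: IH.
Qed.

Lemma adjacent_ins C w : all (sorted ltn) C -> adjacent C -> adjacent (ins C w).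
Proof.
elim: w C => //= x w IH C sC aC; apply: IH; last exact: adjacent_cinsert.
exact: (ins_sorted [:: x]).
Qed.

Lemma row_ins n C w : all (row n) C -> all (fun x => 0 < x <= n) w -> all (row n) (ins C w).
Proof.
elim: w C => //= x w IH C rC /andP [hx hw]; apply: IH => //.
elim: C x hx rC {w hw} => [|c C IH] x hx; first by rewrite /row /= hx.
move=> /andP [rc rC]; rewrite cinsert_cons /= row_cput //=.
case: (cout_nil_or_one c x) => [->|[y -> yc]] //=.
by apply: IH => //; apply: row_mem rc yc.
Qed.

Lemma sorted_count c i t : sorted ltn c ->
  (i < count (gtn t) c) = (i < size c) && (nth 0 c i < t).
Proof.
elim: c i => [|a c IH] i //= sa.
have ha := order_path_min ltn_trans sa; have {}IH := IH _ (path_sorted sa).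
case: (ltnP a t) => at_ /=.
  by case: i => [|i] //=; rewrite add1n ltnS IH.
rewrite add0n (@eq_in_count _ _ pred0) ?count_pred0; last first.
  by move=> z zc /=; move/allP: ha => /(_ z zc); lia.
case: i => [|i] /=; first by lia.
rewrite ltnS; case: (ltnP i (size c)) => //= hi; have /= := allP ha _ (mem_nth 0 hi).
by lia.
Qed.

(** Entrywise counterpart of [lecol], whose counts are easier to follow through an insertion. *)
Definition tabcol (c c' : seq nat) :=
  forall i, i < size c' -> (i < size c) && (nth 0 c i <= nth 0 c' i).

Lemma lecol_tabcol c c' : sorted ltn c -> sorted ltn c' -> lecol c c' -> tabcol c c'.
Proof.
move=> sc sc' h i hi; rewrite -[nth 0 c i <= _]ltnS -(sorted_count _ _ sc).
by apply: leq_trans (h _); rewrite (sorted_count _ _ sc') hi ltnSn.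
Qed.

(** Each letter of [t] bumps the entry of [s] at its own height, since the entries below have
    already been replaced by smaller letters; [p] collects these. *)
Lemma puts_tabcol p t s : sorted ltn (p ++ t) -> tabcol t s ->
  puts (p ++ s) t = p ++ t /\ outs (p ++ s) t = s.
Proof.
elim: t p s => [|x t IH] p s hs h.
  by case: s h => [|a s] // /(_ 0 isT).
have hp : all (gtn x) p.
  move: hs; rewrite sorted_cat_ltn => /and3P [_ _ /allrelP s3].
  by apply/allP => y yc; apply: s3 => //; exact: mem_head.
have hx : x <= head x s by case: s h => //= y s /(_ 0 isT).
rewrite -cat_rcons in hs.
have [|e1 e2] := IH (rcons p x) (behead s) hs.
  by move=> i hi; case: s h {hx} hi => //= y s h hi; have := h i.+1 hi.
rewrite /= !(cput_split hp hx) -cat_rcons /puts /= -/puts e1 e2 cat_rcons; split=> //.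
by case: (s) => //= a l; rewrite take0.
Qed.

(** The first column is bumped out whole and enters the next one in the same way, so all columns
    shift one place to the right. *)
Lemma ins_column C c : c != [::] -> sorted ltn c -> all (sorted ltn) C ->
  all (fun c => c != [::]) C ->
  (forall j, tabcol (nth [::] (c :: C) j) (nth [::] C j)) -> ins C c = c :: C.
Proof.
elim: C c => [|c1 C IH] c c0 sc sC C0 h.
  have [e1 e2] := @puts_tabcol [::] c [::] sc (fun i (hi : i < 0) => ltac:(by [])).
  by rewrite ins_nil //= e1 e2.
move: sC C0 => /= /andP [s1 sC] /andP [c10 C0].
have [e1 e2] := @puts_tabcol [::] c c1 sc (h 0).
by rewrite ins_cons e1 e2 IH // => j; exact: (h j.+1).
Qed.

Lemma ins_reading C : all (sorted ltn) C -> all (fun c => c != [::]) C ->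
  (forall j, tabcol (nth [::] C j) (nth [::] C j.+1)) ->
  ins [::] (flatten (rev C)) = C.
Proof.
elim: C => // c C IH /= /andP [sc sC] /andP [c0 C0] h.
rewrite rev_cons -cats1 flatten_cat /= cats0 ins_cat IH //; last by move=> j; exact: (h j.+1).
by apply: ins_column.
Qed.

(** * The major index *)

Lemma pick_cycP av c :
  match pick_cyc av c with
  | Some d => d \in av /\
      (if c <= d then forall e, e \in av -> c <= e -> d <= e
       else forall e, e \in av -> e < c)
  | None => av = [::]
  end.
Proof.
rewrite /pick_cyc; case E: [seq d <- sort leq av | c <= d] => [|d s].
  have h e : e \in av -> e < c.
    move=> he; rewrite ltnNge; apply/negP => ce.
    have : e \in [seq d <- sort leq av | c <= d] by rewrite mem_filter ce mem_sort.
    by rewrite E.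
  case S: (sort leq av) => [|d s] /=.
    by apply/eqP; rewrite -size_eq0 -(size_sort leq) S.
  have dav : d \in av by rewrite -(mem_sort leq) S mem_head.
  by rewrite leqNgt h.
have : d \in [seq d <- sort leq av | c <= d] by rewrite E mem_head.
rewrite mem_filter mem_sort => /andP [-> dav]; split=> // e eav ce.
have : e \in [seq d <- sort leq av | c <= d] by rewrite mem_filter ce mem_sort.
have : sorted leq [seq d <- sort leq av | c <= d].
  by apply: sorted_filter; [exact: leq_trans | apply: sort_sorted leq_total _].
rewrite E /= => /(order_path_min leq_trans) /allP h; rewrite inE => /orP [/eqP -> //|/h //].
Qed.

Definition gstep r (s : seq nat * seq (nat * nat) * nat) (p : nat * nat) :=
  let: (av, asg, a) := s in
  match pick_cyc av p.1 with
  | Some d => (rem d av, (d, p.2) :: asg, a + (if d < p.1 then p.2 - r + 1 else 0))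
  | None => s
  end.

(** As [d] is the nearest available ball, thresholds between [c] and [d] count the same available
    balls as [c] does; removing the pair thus preserves Hall's condition both ways. *)
Lemma dom_cons_inv c us d av : d \in av -> c <= d ->
  (forall e, e \in av -> c <= e -> d <= e) ->
  dom (c :: us) av <-> dom us (rem d av).
Proof.
move=> dav cd hmin.
have hr x : count (leq x) av = (x <= d) + count (leq x) (rem d av).
  by rewrite (permP (perm_to_rem dav)).
split=> h x; last first.
  by rewrite hr /=; move: (h x); lia.
move: (h x) (h c); rewrite !hr /= leqnn cd.
case: (leqP x c) => xc; first by lia.
case: (leqP x d) => xd; last by lia.
have -> : count (leq c) (rem d av) = count (leq x) (rem d av).
  apply: eq_in_count => e /mem_rem eav; apply/idP/idP => h1; last by lia.
  exact: leq_trans xd (hmin _ eav h1).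
have : count (leq x) us <= count (leq c) us by apply: sub_count => e /=; lia.
by lia.
Qed.

(* Nearest-to-the-right pairing never has to wrap when [dom] holds, in whatever
   order the upper balls are treated. *)
Lemma gfoldP r us av asg a :
  let: (av', asg', a') := foldl (gstep r) (av, asg, a) us in
  [/\ perm_eq (av' ++ map fst asg') (av ++ map fst asg), a <= a',
      dom (map fst us) av -> a' = a &
      a' = a -> size us <= size av -> dom (map fst us) av].
Proof.
elim: us av asg a => [|[c l] us IH] av asg a; first by [].
rewrite [foldl _ _ _]/=; have := pick_cycP av c.
case: (pick_cyc av c) => [d [dav hd]|av0].
  have := IH (rem d av) ((d, l) :: asg) (a + (if d < c then l - r + 1 else 0)).
  case: (foldl _ _ _) => [[av' asg'] a'] /= [p1 le1 d1 d2].
  have sz : size (rem d av) = (size av).-1 by rewrite size_rem.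
  have pos : 0 < size av by case: (av) dav.
  split.
  - apply: (perm_trans p1); rewrite /= perm_sym.
    apply: (perm_trans (y := (d :: rem d av) ++ map fst asg)).
      by rewrite perm_cat2r perm_to_rem.
    by apply/permP => z; rewrite /= !count_cat /=; lia.
  - by lia.
  - move=> h; have cd : c <= d.
      case: (leqP c d) hd => // dc hd; have := h c; rewrite /= leqnn.
      rewrite (@eq_in_count _ (leq c) pred0 av) ?count_pred0 //.
      by move=> e /hd /=; lia.
    rewrite cd in hd; move: h => /(dom_cons_inv _ dav cd hd) /d1 ->.
    by rewrite ltnNge cd addn0.
  - move=> ea hs.
    (* The [+ 1] makes a wrapping pairing cost at least one even where [l - r] truncates to 0. *)
    have : ~~ (d < c) by apply/negP => dc; move: le1; rewrite dc /=; lia.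
    rewrite -leqNgt => cd; rewrite cd in hd.
    apply/(dom_cons_inv _ dav cd hd); apply: d2; last by rewrite sz; lia.
    by move: le1; rewrite ltnNge cd /=; lia.
subst av; have := IH [::] asg a.
case: (foldl _ _ _) => [[av' asg'] a'] /= [p1 le1 d1 d2]; split=> //.
by move/dom_size.
Qed.

Lemma maj_stepP r U acc lower :
  let: (U', acc') := maj_step r (U, acc) lower in
  [/\ perm_eq (map fst U') lower, acc <= acc',
      dom (map fst U) lower -> acc' = acc &
      acc' = acc -> size U <= size lower -> dom (map fst U) lower].
Proof.
rewrite /maj_step -/(gstep r).
have := gfoldP r (sort lab_ord U) lower [::] acc.
case: (foldl _ _ _) => [[av asg] a'] /= [p1 le1 d1 d2].
have hU x : count (leq x) (map fst (sort lab_ord U)) = count (leq x) (map fst U).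
  by rewrite !count_map; apply/permP; rewrite perm_sort.
split=> //.
- rewrite map_cat -map_comp (eq_map (g := id)) ?map_id //.
  by rewrite perm_catC; move: p1; rewrite cats0.
- by move=> h; apply: d1 => x; rewrite hU.
- by rewrite size_sort in d2 => e hs x; rewrite -hU; apply: d2.
Qed.

(** Contributions are nonnegative, so [maj M] vanishes iff no step adds anything, and [maj_stepP]
    treats each step. The weakly decreasing sizes ensure that every upper ball gets a partner. *)
Lemma maj_chain M : (forall k, size (nth [::] M k.+1) <= size (nth [::] M k)) ->
  maj M = 0 <-> chain M.
Proof.
move=> hs; rewrite /maj.
(* Any labelling [U] of the row at position [i] is allowed; the steps left are [i.+1] down to 2. *)
suff h i U acc : perm_eq (map fst U) (nth [::] M i) ->
    let res := (foldl (fun st r => maj_step r st (nth [::] M r.-2)) (U, acc) (rev (iota 2 i))).2 in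
    acc <= res /\ (res = acc <-> forall k, k < i -> dom (nth [::] M k.+1) (nth [::] M k)).
  have [|_ ->] := h (size M).-1 [seq (c, size M) | c <- nth [::] M (size M).-1] 0.
    by rewrite -map_comp (eq_map (g := id)) ?map_id.
  split=> [h1 k|h1 k _]; last exact: h1.
  case: (ltnP k (size M).-1) => hk; first exact: h1.
  by rewrite nth_default //; lia.
elim: i U acc => [|i IH] U acc pU; first by split.
have -> : rev (iota 2 i.+1) = i.+2 :: rev (iota 2 i).
  by rewrite -[in LHS](addn1 i) iotaD rev_cat /= add2n.
rewrite (_ : foldl _ _ (_ :: _) = foldl (fun st r => maj_step r st (nth [::] M r.-2))
  (maj_step i.+2 (U, acc) (nth [::] M i)) (rev (iota 2 i))) //.
have := maj_stepP i.+2 U acc (nth [::] M i).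
case: (maj_step _ _ _) => U' acc' [p1 le1 d1 d2].
have [le2 h2] := IH U' acc' p1.
have hU x : count (leq x) (map fst U) = count (leq x) (nth [::] M i.+1) by apply/permP.
split; first exact: leq_trans le1 le2.
split=> [e k|h].
  have e1 : acc' = acc.
    by apply/eqP; rewrite eqn_leq le1 andbT; apply: leq_trans le2 _; rewrite e.
  rewrite ltnS leq_eqVlt => /orP [/eqP ->|]; last first.
    by move: k; apply/h2; exact: etrans e (esym e1).
  move=> x; rewrite -hU; apply: d2 => //.
  by rewrite -(size_map fst) (perm_size pU).
have <- : acc' = acc by apply: d1 => x; rewrite hU; apply: h.
by apply/h2 => k hk; apply: h; apply: leqW.
Qed.

(** * Transposition of tableaux and the theorem *)

(** Both sides say that the cell in row [i] and column [j] belongs to the diagram. *)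
Lemma conj_part_lt la i j : sorted geq la -> (i < conj_part la j) = (j < nth 0 la i).
Proof.
rewrite /conj_part; elim: la i => [|a la IH] i //= sa; first by rewrite nth_nil.
have geq_trans : transitive geq by move=> x y z /= h1 h2; apply: leq_trans h1.
have /allP ha := order_path_min geq_trans sa.
have {}IH := IH _ (path_sorted sa).
case: (ltnP j a) => ja /=; first by case: i => [|i] //=; rewrite add1n ltnS IH.
rewrite add0n (@eq_in_count _ _ pred0) ?count_pred0; last first.
  by move=> z /ha /= hz; lia.
case: i => [|i] /=; first by lia.
case: (ltnP i (size la)) => hi; last by rewrite nth_default.
by have /= := ha _ (mem_nth 0 hi); lia.
Qed.

Lemma filter_size_take (T : seq (seq nat)) j : sorted geq (map size T) ->
  [seq r <- T | j < size r] = take (conj_part (map size T) j) T.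
Proof.
elim: T => // r T IH sT /=; rewrite /conj_part /= -/(conj_part _ j).
have := conj_part_lt 0 j sT; rewrite /conj_part /= -/(conj_part _ j).
rewrite IH ?(path_sorted sT) //; case: (j < size r) => //=.
by rewrite add0n => h; rewrite (_ : conj_part _ j = 0) ?take0 //; lia.
Qed.

Definition conjp la := [seq conj_part la j | j <- iota 0 (head 0 la)].

Section Transpose.
Variable T : seq (seq nat).
Hypothesis sT : sorted geq (map size T).

Lemma tcolE j : tcol T j = [seq nth 0 r j | r <- take (conj_part (map size T) j) T].
Proof. by rewrite /tcol filter_size_take. Qed.

Lemma size_tcol j : size (tcol T j) = conj_part (map size T) j.
Proof. by rewrite size_map size_filter /conj_part count_map. Qed.

Lemma nth_tcol i j : nth 0 (tcol T j) i = nth 0 (nth [::] T i) j.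
Proof.
have h := conj_part_lt i j sT.
case: (ltnP i (conj_part (map size T) j)) => hi.
  rewrite tcolE (nth_map [::]) ?nth_take // size_takel //.
  by rewrite -(size_map size T); apply: count_size.
rewrite [LHS]nth_default ?size_tcol // nth_default //.
move: h; rewrite ltnNge hi /=; case: (ltnP i (size T)) => iT.
  by rewrite (nth_map [::]) // => /esym /negbT; rewrite -leqNgt.
by move=> _; rewrite [nth [::] T i]nth_default.
Qed.

Lemma nth_tcols j : nth [::] (tcols T) j = tcol T j.
Proof.
case: (ltnP j (head 0 (map size T))) => hj.
  by rewrite (nth_map 0) ?nth_iota ?size_iota //; case: (T) hj.
rewrite nth_default; last by rewrite size_map size_iota; case: (T) hj.
apply/esym/eqP; rewrite -size_eq0 size_tcol -leqn0 leqNgt conj_part_lt // nth0.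
by rewrite -leqNgt.
Qed.

Lemma shape_tcols : map size (tcols T) = conjp (map size T).
Proof.
rewrite /tcols -map_comp /conjp; have -> : head 0 (map size T) = size (head [::] T) by case: (T).
by apply: eq_map => j; rewrite /= size_tcol.
Qed.
End Transpose.

Lemma conjp_sorted la : sorted geq (conjp la).
Proof.
rewrite /conjp; move: (iota_ltn_sorted 0 (head 0 la)); apply: homo_sorted.
by move=> i j ij; apply: sub_count => x /=; lia.
Qed.

Lemma conj_part_conjp la i : sorted geq la -> conj_part (conjp la) i = nth 0 la i.
Proof.
move=> sla; rewrite {1}/conj_part count_map.
rewrite (@eq_count _ _ (fun j => j < nth 0 la i)); last first.
  by move=> j /=; rewrite conj_part_lt.
have le : nth 0 la i <= head 0 la.
  rewrite -nth0 leqNgt -conj_part_lt // -leqNgt.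
  have := conj_part_lt 0 (nth 0 la 0) sla; rewrite ltnn; lia.
rewrite -(subnKC le) iotaD count_cat add0n.
rewrite [X in _ + X](@eq_in_count _ _ pred0) ?count_pred0 ?addn0; last first.
  by move=> j; rewrite mem_iota /=; lia.
rewrite (@eq_in_count _ _ predT) ?count_predT ?size_iota // => j.
by rewrite mem_iota /=; lia.
Qed.

Lemma head_conjp la : is_partition la -> head 0 (conjp la) = size la.
Proof.
case/andP => _ hp; rewrite /conjp; case: la hp => //= a la /andP [a0 hp].
case: a a0 => // a _ /=; rewrite /conj_part /=; congr _.+1.
by apply/eqP; rewrite -all_count.
Qed.

Lemma conjpK la : is_partition la -> conjp (conjp la) = la.
Proof.
move=> pla; have /andP [sla _] := pla; apply: (@eq_from_nth _ 0).
  by rewrite size_map size_iota head_conjp.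
move=> i; rewrite size_map size_iota => hi.
by rewrite (nth_map 0) ?nth_iota ?size_iota // conj_part_conjp.
Qed.

Lemma conjp_pos la : sorted geq la -> all (ltn 0) (conjp la).
Proof.
move=> sla; apply/allP => x /mapP [j]; rewrite mem_iota /= => hj ->.
by rewrite conj_part_lt // nth0.
Qed.

Lemma tcolsK T : is_partition (map size T) -> tcols (tcols T) = T.
Proof.
move=> pT; have /andP [sT _] := pT.
have sC : sorted geq (map size (tcols T)) by rewrite shape_tcols //; apply: conjp_sorted.
have sh : map size (tcols (tcols T)) = map size T by rewrite !shape_tcols // conjpK.
apply: (@eq_from_nth _ [::]); first by rewrite -(size_map size) sh size_map.
move=> i hi; have si : size (nth [::] (tcols (tcols T)) i) = size (nth [::] T i).
  have hi' : i < size T by rewrite -(size_map size) -sh size_map.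
  by rewrite -(nth_map _ 0) // sh (nth_map [::]).
apply: (@eq_from_nth _ 0) => // j hj.
by rewrite nth_tcols // nth_tcol // nth_tcols // nth_tcol.
Qed.

Definition is_tab n C := [/\ all (row n) C, all (fun c => c != [::]) C &
  forall j, tabcol (nth [::] C j) (nth [::] C j.+1)].

Lemma SSYT_tcols la n T : is_partition la -> is_SSYT la n T ->
  [/\ is_tab n (tcols T), map size (tcols T) = conjp la & tcols (tcols T) = T].
Proof.
move=> pla /and4P [/eqP sh aT sT cT]; rewrite -sh in pla *; have /andP [sla _] := pla.
split; [|exact: shape_tcols|exact: tcolsK].
have lt i j : (i < size (tcol T j)) = (j < size (nth [::] T i)).
  rewrite size_tcol conj_part_lt //; case: (ltnP i (size T)) => hi.
    by rewrite (nth_map [::]).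
  by rewrite !nth_default ?size_map.
split.
- apply/allP => c /mapP [j _ ->]; apply/andP; split.
    apply/(sortedP 0) => i hi; rewrite !nth_tcol //.
    move/allP: cT => /(_ i); rewrite mem_iota add0n /=.
    rewrite lt in hi; case: (ltnP i.+1 (size T)) => iT; last by rewrite nth_default in hi.
    have -> : i < (size T).-1 by lia.
    by move=> /(_ isT) /allP; apply; rewrite mem_iota.
  apply/allP => x /mapP [r]; rewrite mem_filter => /andP [jr rT] ->.
  by move/allP: aT => /(_ r rT) /allP; apply; apply: mem_nth.
- have := conjp_pos sla; rewrite -shape_tcols // all_map; apply: sub_all => c /=.
  by case: c.
move=> j i; rewrite !nth_tcols // !lt !nth_tcol // => hi.
rewrite (ltnW hi) /=; case: (ltnP i (size T)) => iT; last by rewrite [nth [::] _ _]nth_default in hi.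
by move/allP: sT => /(_ _ (mem_nth [::] iT)) /(sortedP 0); apply.
Qed.

Lemma tab_SSYT la n C : is_partition la -> is_tab n C -> map size C = conjp la ->
  is_SSYT la n (of_cols C).
Proof.
(* Both [of_cols] and [tcols] are transposition and are convertible. *)
move=> pla [rC C0 tC] sh; rewrite -[of_cols C]/(tcols C); have /andP [sla _] := pla.
have sC : sorted geq (map size C) by rewrite sh conjp_sorted.
have sh2 : map size (tcols C) = la by rewrite shape_tcols // sh conjpK.
have lt i j : (i < size (tcol C j)) = (j < size (nth [::] C i)).
  rewrite size_tcol conj_part_lt //; case: (ltnP i (size C)) => hi.
    by rewrite (nth_map [::]).
  by rewrite !nth_default ?size_map.
apply/and4P; split; first exact/eqP.
- apply/allP => r /mapP [j _ ->]; apply/allP => x /mapP [c]; rewrite mem_filter => /andP [jc cC] ->.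
  by apply: (row_mem (allP rC _ cC)); apply: mem_nth.
- apply/allP => r /mapP [j _ ->]; apply/(sortedP 0) => i; rewrite lt !nth_tcol // => hi.
  by have /andP [] := tC i j hi.
apply/allP => r _; apply/allP => j; rewrite mem_iota add0n /= !nth_tcols // lt !nth_tcol // => hj.
have jC : j < size C by case: (ltnP j (size C)) => // h; rewrite nth_default in hj.
by have /row_sorted /(sortedP 0) := allP rC _ (mem_nth [::] jC); apply.
Qed.

Lemma MLQ_rows la n M : is_MLQ la n M <-> all (row n) M /\ map size M = conjp la.
Proof.
split=> [/andP [/eqP sM /allP h]|[/allP rM sh]].
  split.
    apply/(all_nthP [::]) => i hi; have := h i; rewrite mem_iota => /(_ hi) /and3P [h1 h2 _].
    exact/andP.
  apply: (@eq_from_nth _ 0); first by rewrite !size_map size_iota.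
  move=> i; rewrite size_map => hi; rewrite !(nth_map 0 0) ?(nth_map [::]) ?size_iota -?sM //.
  have := h i; rewrite mem_iota => /(_ hi) /and3P [_ _ /eqP ->].
  by rewrite nth_iota // -sM.
have sM : size M = head 0 la by rewrite -(size_map size) sh size_map size_iota.
apply/andP; split; first exact/eqP.
apply/allP => i; rewrite mem_iota add0n /= => hi.
have /andP [-> ->] := rM _ (mem_nth [::] hi).
by rewrite -(nth_map [::] 0) // sh (nth_map 0) ?size_iota -?sM // nth_iota -?sM ?eqxx //.
Qed.

Lemma MLQ0_rows la n M : sorted geq la ->
  is_MLQ0 la n M <-> [/\ all (row n) M, map size M = conjp la & chain M].
Proof.
move=> sla; suff h : is_MLQ la n M -> maj M = 0 <-> chain M.
  split=> [/andP [h1 /eqP /(h h1) h2]|[h1 h2 h3]]; first by have [] := (MLQ_rows la n M).1 h1.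
  have hM := (MLQ_rows la n M).2 (conj h1 h2).
  by apply/andP; split => //; apply/eqP/(h hM).
move=> /MLQ_rows [_ sh]; apply: maj_chain => k.
case: (ltnP k.+1 (size M)) => hk; last by rewrite nth_default.
have := conjp_sorted la => /(sortedP 0) /(_ k).
by rewrite -sh size_map !(nth_map [::]) //; [apply | apply: ltnW].
Qed.

Lemma drop_nils_nseq k B : drop_nils (nseq k [::] ++ B) = drop_nils B.
Proof. by elim: k. Qed.

Lemma drop_nils_id B : all (fun r => r != [::]) B -> drop_nils B = B.
Proof. by case: B => [|[|x r] B]. Qed.

(** Row sizes weakly decrease along a chain, so all its empty rows are at the top and trimming is
    filtering. *)
Lemma chain_trim N : chain N ->
  trim N = [seq r <- N | r != [::]] /\ exists k, N = trim N ++ nseq k [::].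
Proof.
move=> ch; suff [k e] : exists k, N = [seq r <- N | r != [::]] ++ nseq k [::].
  have et : trim N = [seq r <- N | r != [::]].
    rewrite /trim {1}e rev_cat rev_nseq drop_nils_nseq drop_nils_id ?revK //.
    by rewrite all_rev filter_all.
  by split=> //; exists k; rewrite et.
elim: N ch => [|B N IH] ch; first by exists 0.
case: B ch => [|b B] ch /=; last by have [k {1}->] := IH (chain_cons ch); exists k.
have e : N = nseq (size N) [::].
  move/chain_nil: ch; elim: (N) => //= B N' IHN; by case: B => //= /IHN {1}->.
exists (size N).+1; rewrite {1}e /= (_ : [seq _ <- N | _] = [::]) // e.
by elim: (size N).
Qed.

Lemma trimP n N : all (row n) N -> chain N ->
  [/\ all (row n) (trim N), chain (trim N), rw (trim N) = rw N &
      map size (trim N) = [seq k <- map size N | 0 < k]].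
Proof.
move=> rN ch; have [e [k ek]] := chain_trim ch; split.
- by rewrite e all_filter; apply: sub_all rN => r /= ->; apply: implybT.
- have hn j : nth [::] (trim N) j = nth [::] N j.
    by rewrite [in RHS]ek nth_cat nth_nseq; case: ltnP => // h; rewrite nth_default // if_same.
  by move=> j; rewrite !hn.
- rewrite [in RHS]ek /rw flatten_cat; elim: k {ek} => //=; by rewrite cats0.
by rewrite e filter_map; congr map; apply: eq_filter; case.
Qed.

Lemma mlq_tab la n T : is_partition la -> is_SSYT la n T ->
  is_MLQ0 la n (mlq n T) /\ ins [::] (rw (mlq n T)) = tcols T.
Proof.
move=> pla sT; have /andP [sla _] := pla.
have [[rC C0 tC] sh _] := SSYT_tcols pla sT.
have ew : revcrw T = flatten (rev (tcols T)).
  rewrite /revcrw /crw; elim: (tcols T) => //= c C IH.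
  by rewrite rev_cat revK IH rev_cons -cats1 flatten_cat /= cats0.
have hw : all (fun x => 0 < x <= n) (revcrw T).
  rewrite ew; apply/allP => x /flattenP [c]; rewrite mem_rev => cC.
  by apply: row_mem; apply: (allP rC).
have [rN cN pN] := rhoP hw.
have [r1 c1 e1 s1] := trimP rN cN.
have eI : ins [::] (rw (mlq n T)) = tcols T.
  rewrite /mlq e1 pN // ew ins_reading //.
  by apply: sub_all rC => c; apply: row_sorted.
split=> //; apply/MLQ0_rows => //; split=> //.
(* Here [ins_shape] is read backwards: the columns of [T] give the row sizes of [mlq n T]. *)
by rewrite s1 -(ins_shape rN cN) -/(rw _) -e1 -/(mlq n T) eI.
Qed.

Lemma ins_MLQ0 la n M : is_partition la -> is_MLQ0 la n M ->
  is_tab n (ins [::] (rw M)) /\ map size (ins [::] (rw M)) = conjp la.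
Proof.
move=> /andP [sla _] /(MLQ0_rows _ _ sla) [rM sM cM].
have sh : map size (ins [::] (rw M)) = conjp la.
  by rewrite (ins_shape rM cM) sM; apply/all_filterP; apply: conjp_pos.
have rI : all (row n) (ins [::] (rw M)).
  apply: row_ins => //; apply/allP => x /flattenP [B BM].
  by apply: row_mem; apply: (allP rM).
split=> //; split=> //.
  have := conjp_pos sla; rewrite -sh all_map; apply: sub_all => c /=.
  by case: c.
move=> j; apply: lecol_tabcol; try exact: row_sorted (row_nth _ rI).
by apply: adjacent_ins.
Qed.

Theorem theoremA4 (la : seq nat) (n : nat) :
  is_partition la -> size la <= n ->
  [/\ (forall T, is_SSYT la n T -> is_MLQ0 la n (mlq n T)),
      (forall M, is_MLQ0 la n M -> is_SSYT la n (tab M)),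
      (forall T, is_SSYT la n T -> tab (mlq n T) = T) &
      (forall M, is_MLQ0 la n M -> mlq n (tab M) = M)].
Proof.
move=> pla _.
have wd1 T : is_SSYT la n T -> is_MLQ0 la n (mlq n T) by case/(mlq_tab pla).
have wd2 M : is_MLQ0 la n M -> is_SSYT la n (tab M).
  by move=> /(ins_MLQ0 pla) [h1 h2]; apply: tab_SSYT.
have tabK T : is_SSYT la n T -> tab (mlq n T) = T.
  move=> sT; have [_ e] := mlq_tab pla sT; have [_ _ eT] := SSYT_tcols pla sT.
  by rewrite -[LHS]/(tcols (ins [::] (rw (mlq n T)))) e.
split=> // M hM; have sT := wd2 _ hM; have hM' := wd1 _ sT.
have /andP [sla _] := pla.
have [r1 s1 c1] := (MLQ0_rows n _ sla).1 hM'; have [r2 s2 c2] := (MLQ0_rows n _ sla).1 hM.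
(* Both queues are chains with the same row sizes, and both insert to [tab M]. *)
apply: (chain_inj r1 r2 c1 c2); first by rewrite s1 s2.
have [_ e] := mlq_tab pla sT; rewrite -/(rw _) e.
rewrite -[tab M]/(tcols (ins [::] (rw M))) tcolsK //.
by have [_ ->] := ins_MLQ0 pla hM; rewrite /is_partition conjp_sorted conjp_pos.
Qed.
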